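(* For every $\gamma\in(0,1)$ there exists $\tau_0>0$ such that for every $\tau\in(0,\tau_0]$ there exists $\nu_0>0$ such that for every $\nu\in(0,\nu_0]$ there exists $\mu_0>0$ such that for every $\mu\in(0,\mu_0]$ there exists $n_0$ such that for all $n\ge n_0$: if $G$ is a graph on $n$ vertices with $\delta(G)\ge\gamma n$ which is a robust $(\nu,\tau)$-expander, then for every $\mu n$-bounded colouring of $E(G)$, $G$ contains a rainbow Hamilton cycle.
   Context: For $0<\nu<1$ and $X\subseteq V(G)$, where $|V(G)|=n$, the $\nu$-robust neighbourhood of $X$ is $RN_\nu(X)=\{v\in V(G): |N_G(v)\cap X|\ge\nu n\}$. For $0<\nu\le\tau<1$, $G$ is a robust $(\nu,\tau)$-expander if $|RN_\nu(X)|\ge |X|+\nu n$ for every $X\subseteq V(G)$ with $\tau n\le|X|\le(1-\tau)n$. An edge-colouring is $k$-bounded if no colour appears on more than $k$ edges; a subgraph is rainbow if its edges have pairwise distinct colours. *)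

(* Defs.v *)
From HB Require Import structures.
From mathcomp Require Import all_boot all_order all_algebra.
Set Implicit Arguments. Unset Strict Implicit. Unset Printing Implicit Defensive.
Import Order.TTheory GRing.Theory Num.Theory.
Local Open Scope ring_scope.

Definition simple_graph (n : nat) (e : rel 'I_n) : Prop :=
  (forall x, ~~ e x x) /\ (forall x y, e x y = e y x).

Definition nbhd (n : nat) (e : rel 'I_n) (v : 'I_n) : {set 'I_n} :=
  [set u | e v u].

Definition min_degree_ge (R : realFieldType) (n : nat) (e : rel 'I_n) (d : R) : Prop :=
  forall v : 'I_n, d <= (#|nbhd e v|)%:R.

Definition robust_nbhd (R : realFieldType) (n : nat) (e : rel 'I_n) (nu : R)
  (X : {set 'I_n}) : {set 'I_n} :=
  [set v | nu * n%:R <= (#|nbhd e v :&: X|)%:R].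

Definition robust_expander (R : realFieldType) (n : nat) (e : rel 'I_n) (nu tau : R) : Prop :=
  [/\ 0 < nu, nu <= tau, tau < 1 &
   forall X : {set 'I_n},
     tau * n%:R <= (#|X|)%:R -> (#|X|)%:R <= (1 - tau) * n%:R ->
     (#|X|)%:R + nu * n%:R <= (#|robust_nbhd e nu X|)%:R].

Definition edge_colouring (n : nat) (e : rel 'I_n) (C : eqType) (c : 'I_n -> 'I_n -> C) : Prop :=
  forall x y, e x y -> c x y = c y x.

(* edges of colour k (each unordered edge counted once, as the pair x < y) *)
Definition colour_class (n : nat) (e : rel 'I_n) (C : eqType) (c : 'I_n -> 'I_n -> C) (k : C)
  : {set 'I_n * 'I_n} :=
  [set p : 'I_n * 'I_n | [&& (p.1 < p.2)%N, e p.1 p.2 & c p.1 p.2 == k]].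

Definition bounded_colouring (R : realFieldType) (n : nat) (e : rel 'I_n) (C : eqType)
  (c : 'I_n -> 'I_n -> C) (k : R) : Prop :=
  forall col : C, (#|colour_class e c col|)%:R <= k.

Definition hamilton_cycle (n : nat) (e : rel 'I_n) (s : seq 'I_n) : Prop :=
  [/\ (3 <= size s)%N, uniq s, size s = n & cycle e s].

Definition rainbow_cycle (n : nat) (C : eqType) (c : 'I_n -> 'I_n -> C) (s : seq 'I_n) : Prop :=
  uniq [seq c p.1 p.2 | p <- zip s (rot 1 s)].

(* Main.v *)
(** Reserve a set [U] of colours that every vertex sees with the same small density (a
    Beck--Fiala rounding achieves this for all vertices at once), so that the unreserved
    edges still form a robust expander. In the unreserved graph, build greedily a short
    rainbow path made of absorbing blocks, so rich that any pair [(y, x)] is absorbed, by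
    reserved edges, by linearly many blocks; which block to append next is decided by an
    exponential potential over all pairs. Cover the remaining vertices by few rainbow paths:
    a permutation without short cycles records the partial cover, and a bounded alternating
    walk through robust neighbourhoods removes one of its missing arcs as long as there are
    too many. Finally each of these paths, as well as the closing of the absorbing path into
    a cycle, is absorbed by a block of its own through reserved edges. The blocks can be
    chosen with pairwise distinct colours by a counting version of the local lemma; reserved
    colours are needed here because the ends of the paths are arbitrary vertices, whose
    unreserved colours may all have been used. *)

(* The obstacle throughout is that used colours may cluster at a few vertices. Since a colour has
   few edges, double counting shows that only [O(D M)] vertices lose more than [h / 8] edges, which
   is negligible against [h]; every vertex that the construction is free to choose is taken outside
   this set. A vertex that it cannot choose, such as an end of a covering path, is attached by one
   reserved edge. Absorbing a path thus brings in just two new colours, and the only clashes left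
   are those between pairs of such choices.

   The number of covering paths is at most the number of missing arcs plus the number of cycles of
   the permutation. Excluding cycles of length at most [L] bounds the latter by [n / L], and both
   terms have to stay below the number of blocks absorbing a given pair, which is linear in [n].

   The combinatorial part works over the integers: [h], [t], [d] are the real thresholds for
   expansion, set size and degree, rounded up, [D] is slightly more than the inverse of the
   expansion rate, and [M] bounds the ordered pairs carrying one colour. *)
Require Import Defs.
From HB Require Import structures.
From mathcomp Require Import all_boot all_order all_algebra.
From mathcomp Require Import fingroup perm.
From mathcomp Require Import zify ring lra.
Set Implicit Arguments. Unset Strict Implicit. Unset Printing Implicit Defensive.
Import Order.TTheory GRing.Theory Num.Theory.

(** * Discrepancy *)

Section Discrepancy.
Local Open Scope ring_scope.

Lemma mulmx_eq0_ltn (F : fieldType) (p q : nat) (A : 'M[F]_(p, q)) :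
  (q < p)%N -> exists2 u : 'rV_p, u != 0 & u *m A = 0.
Proof.
move=> lt_qp.
have /rowV0Pn [u /sub_kermxP uA u0] : kermx A != 0.
  rewrite -mxrank_eq0 mxrank_ker subn_eq0 -ltnNge.
  exact: leq_ltn_trans (rank_leq_col A) lt_qp.
by exists u.
Qed.

Variables (I J : finType) (A : I -> J -> rat) (B : rat).
Hypotheses (B_ge0 : 0 <= B) (A_ge0 : forall i j, 0 <= A i j) (sumA : forall j, \sum_i A i j <= B).

(** Each column carries mass at most [B] and each constrained row more than [B] on [F], so there are
    fewer constrained rows than columns in [F]: the homogeneous system has more unknowns than
    equations. *)
Lemma kernel_direction (F : {set J}) :
  F != set0 ->
  exists v : J -> rat,
    [/\ exists2 j, j \in F & v j != 0, forall j, j \notin F -> v j = 0 &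
     forall i, B < \sum_(j in F) A i j -> \sum_j A i j * v j = 0].
Proof.
move=> F0; pose Act := [set i | B < \sum_(j in F) A i j].
have [Act0|Act_n0] := eqVneq Act set0.
  have /set0Pn [j0 j0F] := F0.
  exists (fun j => (j == j0)%:R); split.
  - by exists j0; rewrite ?eqxx.
  - by move=> j; case: eqP => // ->; rewrite j0F.
  - by move=> i Bi; have := in_set0 i; rewrite -Act0 inE Bi.
have ltAF : (#|Act| < #|F|)%N.
  have h1 : B * #|Act|%:R < \sum_(i in Act) \sum_(j in F) A i j.
    have /set0Pn [i0 i0A] := Act_n0.
    rewrite mulr_natr -sumr_const (bigD1 i0) //= [X in _ < X](bigD1 i0) //=.
    apply: ltr_leD; first by move: i0A; rewrite inE.
    by apply: ler_sum => i /andP [+ _]; rewrite inE => /ltW.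
  have h2 : \sum_(i in Act) \sum_(j in F) A i j <= B * #|F|%:R.
    rewrite exchange_big /= mulr_natr -sumr_const; apply: ler_sum => j _.
    apply: le_trans (sumA j); rewrite [X in _ <= X](bigID (mem Act)) /= lerDl.
    exact: sumr_ge0.
  have := lt_le_trans h1 h2.
  move=> lt12; rewrite -(ltr_nat rat) ltNge; apply/negP => le12.
  by move: lt12; rewrite ltNge ler_wpM2l.
pose Mx : 'M[rat]_(#|F|, #|Act|) := \matrix_(k, l) A (enum_val l) (enum_val k).
have [u u0 uM] := mulmx_eq0_ltn Mx ltAF.
pose v j := \sum_k u 0 k * (enum_val k == j)%:R.
have vE k : v (enum_val k) = u 0 k.
  rewrite /v (bigD1 k) //= eqxx mulr1 big1 ?addr0 // => l lk.
  by rewrite (inj_eq enum_val_inj) (negPf lk) mulr0.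
exists v; split.
- have /rV0Pn [k uk] := u0.
  by exists (enum_val k); [exact: enum_valP | rewrite vE].
- move=> j jF; rewrite /v big1 // => k _.
  by case: eqP => [kj|_]; [move: jF; rewrite -kj enum_valP | rewrite mulr0].
- move=> i Bi; have iA : i \in Act by rewrite inE.
  have /matrixP/(_ 0 (enum_rank_in iA i)) := uM.
  rewrite !mxE => uMi; rewrite -[RHS]uMi; under eq_bigr do rewrite /v mulr_sumr.
  rewrite exchange_big /=; apply: eq_bigr => k _.
  rewrite (bigD1 (enum_val k)) //= eqxx mulr1 big1 ?addr0.
    by rewrite mxE enum_rankK_in // mulrC.
  by move=> j jk; rewrite eq_sym (negPf jk) !mulr0.
Qed.

Lemma move_to_boundary (x v : J -> rat) (F := [set j | 0 < x j < 1]) :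
  (forall j, 0 <= x j <= 1) -> (exists2 j, j \in F & v j != 0) ->
  (forall j, j \notin F -> v j = 0) ->
  exists t : rat, (forall j, 0 <= x j + t * v j <= 1) /\
    ([set j | 0 < x j + t * v j < 1] \proper F).
Proof.
move=> x01 [j0 j0F vj0] vF.
(* [room j] is how far coordinate [j] can travel along [v] before it hits 1 or 0. Stepping by the
   least room keeps all coordinates in the unit interval and makes one fractional coordinate
   integral. *)
pose room j := if 0 < v j then (1 - x j) / v j else x j / - v j.
have [j1 /andP [_ vj1] jmin] : exists2 j1, (j1 \in F) && (v j1 != 0) &
   forall j, (j \in F) && (v j != 0) -> room j1 <= room j.
  pose P := [pred j | (j \in F) && (v j != 0)].
  have P0 : P j0 by rewrite /= j0F.
  by case: (@arg_minP _ _ _ j0 P room P0) => j1 Pj1 Hmin; exists j1.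
have j1F : j1 \in F by apply: contraR vj1 => /vF ->.
have room_ge0 : 0 <= room j1.
  rewrite /room; have /andP [x0 x1] := x01 j1.
  case: ifP => [v0|/negbT]; first by rewrite divr_ge0 ?subr_ge0 // ltW.
  by rewrite -leNgt => v0; rewrite divr_ge0 // oppr_ge0.
exists (room j1).
have x'01 j : 0 <= x j + room j1 * v j <= 1.
  have /andP [x0 x1] := x01 j.
  have [->|vj] := eqVneq (v j) 0; first by rewrite mulr0 addr0 x0 x1.
  have jF : j \in F by apply: contraR vj => /vF ->.
  have := jmin j; rewrite jF vj => /(_ isT); rewrite {2}/room.
  case: ifP => [v0|/negbT].
    rewrite ler_pdivlMr // => hr.
    have := mulr_ge0 room_ge0 (ltW v0); lra.
  rewrite -leNgt => v0; have v0' : 0 < - v j by rewrite oppr_gt0 lt_neqAle vj.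
  rewrite ler_pdivlMr // mulrN => hr.
  have := mulr_ge0 room_ge0 (ltW v0'); rewrite mulrN; lra.
split=> //; apply/properP; split.
  apply/subsetP => j; rewrite inE => h; apply: contraLR h => /[dup] /vF ->.
  by rewrite mulr0 addr0 inE.
exists j1 => //; rewrite inE negb_and -!leNgt.
rewrite /room; case: ifP => [v0|/negbT].
  by rewrite divfK // subrKC lexx orbT.
by rewrite -leNgt => v0; rewrite invrN mulrN mulNr divfK // subrr lexx.
Qed.

(* Beck--Fiala rounding: a row is kept exact as long as its mass on the fractional columns
   exceeds [B]; afterwards it can change by at most [B]. *)
Lemma beck_fiala_round (x : J -> rat) :
  (forall j, 0 <= x j <= 1) ->
  exists y : J -> rat,
    [/\ forall j, (y j == 0) || (y j == 1),
        forall j, ~~ (0 < x j < 1) -> y j = x j,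
        forall j, 0 <= y j <= 1 &
        forall i, `|\sum_j A i j * (y j - x j)| <= B].
Proof.
have [m] := ubnP #|[set j | 0 < x j < 1]|; elim: m x => // m IHm x cardF x01.
pose F := [set j | 0 < x j < 1]; have [F0|F_n0] := eqVneq F set0.
  have xF j : ~~ (0 < x j < 1) by have := in_set0 j; rewrite -F0 inE => ->.
  exists x; split=> // [j|i].
    have := xF j; rewrite negb_and -!leNgt => /orP [x0|x1].
      by have /andP [x0' _] := x01 j; rewrite eq_le x0 x0'.
    by have /andP [_ x1'] := x01 j; rewrite [x j == 1]eq_le x1 x1' orbT.
  by rewrite big1 ?normr0 // => j _; rewrite subrr mulr0.
have [v [vn0 vF vker]] := kernel_direction F_n0.
have [t [x'01 propF]] := move_to_boundary x01 vn0 vF.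
have [||y [y01 yx' yb yd]] := IHm (fun j => x j + t * v j).
- exact: leq_trans (proper_card propF) _.
- exact: x'01.
- have yx j : j \notin F -> y j = x j.
    move=> jF; rewrite yx' (vF j jF) mulr0 addr0 //.
    by move: jF; rewrite inE.
  exists y; split=> //; first by move=> j h; apply: yx; rewrite inE.
  move=> i; have [le_B|/vker Av] := leP (\sum_(j in F) A i j) B.
    apply: le_trans le_B; rewrite (bigID (mem F)) /= [X in _ + X]big1 ?addr0.
      apply: le_trans (ler_norm_sum _ _ _) _; apply: ler_sum => j _.
      rewrite normrM ger0_norm // ler_piMr // ler_norml.
      by have := yb j; have := x01 j; lra.
    by move=> j /yx ->; rewrite subrr mulr0.
  suff -> : \sum_j A i j * (y j - x j) = \sum_j A i j * (y j - (x j + t * v j)).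
    exact: yd.
  apply/eqP; rewrite -subr_eq0 -sumrB.
  rewrite (eq_bigr (fun j => t * (A i j * v j))) => [|j _]; last by ring.
  by rewrite -mulr_sumr Av mulr0.
Qed.

End Discrepancy.

Local Open Scope nat_scope.

(** Rounds the constant vector [1 / q]. With rows for vertices, columns for colours and entries for
    colour degrees, this selects the reserved colours. *)
Lemma proportional_columns (I J : finType) (A : I -> J -> nat) (B q : nat) :
  0 < q -> (forall j, \sum_i A i j <= B) ->
  exists U : {set J}, forall i,
    \sum_j A i j <= q * (\sum_(j in U) A i j + B) /\
    q * \sum_(j in U) A i j <= \sum_j A i j + q * B.
Proof.
move=> q0 sumA; pose x (j : J) : rat := (q%:R^-1)%R.
have q0R : (0 < q%:R :> rat)%R by rewrite ltr0n.
have [||||y [y01 _ _ yd]] := @beck_fiala_round I J (fun i j => (A i j)%:R%R) B%:R%R _ _ _ x.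
- by rewrite ler0n.
- by move=> i j; rewrite ler0n.
- by move=> j; rewrite -natr_sum ler_nat.
- by move=> j; rewrite /x invr_ge0 ltW //= invf_le1 // ler1n.
exists [set j | y j == 1%R] => i.
have sumU : (\sum_j (A i j)%:R * y j = (\sum_(j in [set j | y j == 1]) A i j)%:R :> rat)%R.
  rewrite natr_sum [RHS]big_mkcond /=; apply: eq_bigr => j _; rewrite inE.
  by case/orP: (y01 j) => /eqP ->; rewrite ?mulr0 ?eqxx ?mulr1.
have := yd i; rewrite (eq_bigr (fun j => (A i j)%:R * y j - (A i j)%:R * x j)%R);
  last by move=> j _; rewrite mulrBr.
rewrite sumrB sumU /x -mulr_suml -natr_sum.
set a := (\sum_j _)%N; set u := (\sum_(j in _) _)%N => /ler_normlP [h1 h2].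
rewrite -!(ler_nat rat) !natrM !natrD !natrM.
have E : ((a%:R : rat) = q%:R * (a%:R / q%:R))%R by rewrite mulrC divfK ?gt_eqF.
rewrite [in X in X /\ _]E [in X in _ /\ X]E -!mulrDr !ler_pM2l //.
by split; lra.
Qed.

(** * Independent transversals *)

Lemma subset_of_card (T : finType) (A : {set T}) (k : nat) :
  k <= #|A| -> exists2 B : {set T}, B \subset A & #|B| = k.
Proof.
move=> kA; exists [set x in take k (enum A)].
  by apply/subsetP => x; rewrite inE => /mem_take; rewrite mem_enum.
rewrite cardsE (card_uniqP _) ?size_takel -?cardE //.
exact/take_uniq/enum_uniq.
Qed.

Lemma card_setU_le (T : finType) (A B : {set T}) : #|A :|: B| <= #|A| + #|B|.
Proof. exact: (leq_card_setU A B). Qed.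

Lemma card_bigcup_le (I T : finType) (P : pred I) (F : I -> {set T}) :
  #|\bigcup_(i | P i) F i| <= \sum_(i | P i) #|F i|.
Proof.
apply: (big_ind2 (fun (X : {set T}) k => #|X| <= k)) => //; first by rewrite cards0.
move=> X1 k1 X2 k2 h1 h2; apply: leq_trans (leq_card_setU _ _) _.
exact: leq_add.
Qed.

Section Transversal.
Variables (I O : finType) (o0 : O) (conf : I -> O -> I -> O -> bool).
Hypothesis conf_sym : forall i o j o', conf i o j o' = conf j o' i o.

Section ExactLists.
Variables (L : I -> {set O}) (w delta : nat).
Hypotheses (w_gt0 : 0 < w) (cardL : forall i, #|L i| = w) (delta_w : 4 * delta <= w).
Hypothesis conf_deg : forall i o, o \in L i ->
  #|[set p : I * O | [&& p.1 != i, p.2 \in L p.1 & conf i o p.1 p.2]]| <= delta.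

(** Conflict-free partial choices on [A]; the default [o0] off [A] makes each of them a single total
    function, so that they can be counted. *)
Let good (A : {set I}) : {set {ffun I -> O}} :=
  [set f : {ffun I -> O} | [forall i, if i \in A then f i \in L i else f i == o0] &&
     [forall i in A, forall j in A, (i != j) ==> ~~ conf i (f i) j (f j)]].

Let upd (f : {ffun I -> O}) (i : I) (o : O) : {ffun I -> O} :=
  [ffun j => if j == i then o else f j].

Let goodP (A : {set I}) (f : {ffun I -> O}) :
  reflect [/\ forall i, i \in A -> f i \in L i, forall i, i \notin A -> f i = o0 &
    forall i j, i \in A -> j \in A -> i != j -> ~~ conf i (f i) j (f j)] (f \in good A).
Proof.
rewrite inE; apply: (iffP andP) => [[/forallP h1 /forall_inP h2]|[h1 h2 h3]]; split.
- by move=> i iA; have := h1 i; rewrite iA.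
- by move=> i iA; have := h1 i; rewrite (negPf iA) => /eqP.
- by move=> i j iA jA ij; have /forall_inP/(_ j jA)/implyP := h2 i iA; apply.
- by apply/forallP => i; case: ifP => [/h1|/negbT/h2 ->].
- apply/forall_inP => i iA; apply/forall_inP => j jA; apply/implyP; exact: h3.
Qed.

Let good_upd_o0 (A : {set I}) j o : j \in A ->
  #|[set f in good A | f j == o]| <= #|good (A :\ j)|.
Proof.
move=> jA; rewrite -(@card_in_imset _ _ (fun f => upd f j o0)).
  apply/subset_leq_card/subsetP => _ /imsetP [f + ->]; rewrite in_set => /andP [fA _].
  have /goodP [h1 h2 h3] := fA; apply/goodP; split.
  - by move=> i; rewrite !inE ffunE => /andP [/negPf -> /h1].
  - by move=> i; rewrite !inE ffunE; case: eqP => //= _ /h2.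
  - move=> i k; rewrite !inE !ffunE => /andP [/negPf -> iA] /andP [/negPf -> kA].
    exact: h3.
move=> f g; rewrite in_set => /andP [_ /eqP fj]; rewrite in_set => /andP [_ /eqP gj] /ffunP fg.
apply/ffunP => i; have := fg i; rewrite !ffunE; case: eqP => [->|//].
by rewrite fj gj.
Qed.

(** Adding a value [o] at [i] to a choice [f] on [A] fails only through some conflict [(j, o')] with
    [f j = o']. By induction at most a fraction [2 / w] of the choices satisfies [f j = o'], and
    there are at most [w * delta] triples [(o, j, o')]. So at most [2 * delta * #|good A|], hence at
    most half, of the pairs [(f, o)] are bad. *)
Let good_extend (A : {set I}) i : i \notin A -> w * #|good A| <= 2 * #|good (i |: A)|.
Proof.
have [m] := ubnP #|A|; elim: m A i => // m IHm A i cardA iA.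
pose P := setX (good A) (L i).
pose bad := [set p in P | [exists j in A, conf i p.2 j (p.1 j)]].
have cardP : #|P| = w * #|good A| by rewrite cardsX cardL mulnC.
have goodI : #|P :\: bad| <= #|good (i |: A)|.
  rewrite -(@card_in_imset _ _ (fun p => upd p.1 i p.2)).
    apply/subset_leq_card/subsetP => _ /imsetP [[f o] + ->].
    rewrite in_setD [_ \in bad]inE => /andP [+ fP]; rewrite fP /=.
    rewrite negb_exists => /forallP nbad; move: fP.
    rewrite in_setX /= => /andP [/goodP [h1 h2 h3] oL].
    have nb j : j \in A -> ~~ conf i o j (f j).
      by move=> jA; have := nbad j; rewrite jA.
    apply/goodP; split=> [k|k|k l].
    - by rewrite !inE ffunE; case: eqP => [->|_ /= /h1].
    - by rewrite !inE ffunE; case: eqP => [->|_ /= /h2].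
    - rewrite !inE !ffunE; case: (k =P i) => [->|_] /=; case: (l =P i) => [->|_] //=.
      + by rewrite eqxx.
      + by move=> _ lA _; exact: nb.
      + by move=> kA _ _; rewrite conf_sym nb.
      + exact: h3.
  move=> [f o] [g o']; rewrite !in_setD !in_setX /=.
  move=> /andP [_ /andP [/goodP [_ fi _] _]] /andP [_ /andP [/goodP [_ gi _] _]].
  move=> /ffunP fg; have := fg i; rewrite !ffunE eqxx => ->; congr pair.
  apply/ffunP => j; have := fg j; rewrite !ffunE; case: eqP => // -> _.
  by rewrite fi // gi.
have cardbad : w * #|bad| <= w * (2 * delta * #|good A|).
  pose N o := [set p : I * O | [&& p.1 != i, p.2 \in L p.1 & conf i o p.1 p.2]].
  have sub : bad \subset \bigcup_(o in L i) \bigcup_(p in N o | p.1 \in A)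
                [set (f, o) | f in [set f in good A | f p.1 == p.2]].
    apply/subsetP => [[f o]]; rewrite inE => /andP [].
    rewrite in_setX /= => /andP [fA oL] /exists_inP [j jA cj].
    apply/bigcupP; exists o => //; apply/bigcupP; exists (j, f j) => /=.
      rewrite inE /= jA cj andbT; apply/and3P; split=> //.
        by apply: contraNneq iA => <-.
      by have /goodP [h1 _ _] := fA; exact: h1.
    by apply/imsetP; exists f => //; rewrite inE fA eqxx.
  have le1 : #|bad| <= \sum_(o in L i) \sum_(p in N o | p.1 \in A) #|good (A :\ p.1)|.
    apply: leq_trans (subset_leq_card sub) _.
    apply: leq_trans (card_bigcup_le _ _) _; apply: leq_sum => o _.
    apply: leq_trans (card_bigcup_le _ _) _; apply: leq_sum => p /andP [_ pA].
    apply: leq_trans (leq_imset_card _ _) _; exact: good_upd_o0.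
  apply: leq_trans (_ : w * \sum_(o in L i) \sum_(p in N o | p.1 \in A) #|good (A :\ p.1)| <= _).
    by rewrite leq_mul2l le1 orbT.
  rewrite big_distrr /=.
  apply: (@leq_trans (\sum_(o in L i) delta * (2 * #|good A|))).
    apply: leq_sum => o oL; rewrite big_distrr /=.
    apply: (@leq_trans (\sum_(p in N o) 2 * #|good A|)).
      rewrite [X in _ <= X](bigID (fun p => p.1 \in A)) /= -[X in X <= _]addn0.
      apply: leq_add => //; apply: leq_sum => p /andP [_ pA].
      have := IHm (A :\ p.1) p.1; rewrite setD1K //; apply; rewrite ?inE ?eqxx //.
      by have := cardA; rewrite (cardsD1 p.1) pA; lia.
    rewrite sum_nat_const leq_mul2r conf_deg ?orbT //.
  by rewrite sum_nat_const cardL [2 * delta]mulnC -mulnA.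
have := cardsD P bad; rewrite (setIidPr _); last by apply/subsetP => p; rewrite inE => /andP [].
have := goodI; rewrite leq_pmul2l // in cardbad.
rewrite cardP => h1 h2.
have : 2 * delta * #|good A| * 2 <= w * #|good A| by nia.
lia.
Qed.
Let good_card_gt0 (A : {set I}) : 0 < #|good A|.
Proof.
have [m] := ubnP #|A|; elim: m A => // m IHm A cardA.
have [->|/set0Pn [i iA]] := eqVneq A set0.
  apply/card_gt0P; exists [ffun => o0]; apply/goodP; split=> [i|i|i j].
  - by rewrite inE.
  - by rewrite ffunE.
  - by rewrite inE.
have IH : 0 < #|good (A :\ i)| by apply: IHm; have := cardA; rewrite (cardsD1 i) iA; lia.
have := @good_extend (A :\ i) i; rewrite !inE eqxx setD1K // => /(_ isT).
by have := muln_gt0 w #|good (A :\ i)|; rewrite w_gt0 IH; lia.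
Qed.

Lemma exact_transversal :
  exists f : I -> O, (forall i, f i \in L i) /\
    (forall i j, i != j -> ~~ conf i (f i) j (f j)).
Proof.
have /card_gt0P [f /goodP [h1 _ h3]] := good_card_gt0 setT.
exists f; split=> [i|i j]; first exact/h1/in_setT.
by apply: h3; rewrite in_setT.
Qed.
End ExactLists.

(* The number of conflict-free choices for the lists in [i |: A] is at least [w / 2] times
   the number for [A]: this counting induction replaces the local lemma. *)
Lemma independent_transversal (L : I -> {set O}) (w delta : nat) :
  0 < w -> (forall i, w <= #|L i|) -> 4 * delta <= w ->
  (forall i o, o \in L i ->
    #|[set p : I * O | [&& p.1 != i, p.2 \in L p.1 & conf i o p.1 p.2]]| <= delta) ->
  exists f : I -> O, (forall i, f i \in L i) /\
    (forall i j, i != j -> ~~ conf i (f i) j (f j)).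
Proof.
move=> w0 wL dw deg.
(* The counting needs lists of size exactly [w]; truncating them can only decrease the conflict
   degrees. *)
have [L' subL cardL'] := fin_all_exists2 (fun i => subset_of_card (wL i)).
have [|f [fL' fconf]] := exact_transversal w0 cardL' dw.
  move=> i o oL; apply: leq_trans (deg i o _); last exact: (subsetP (subL i)).
  apply/subset_leq_card/subsetP => p; rewrite !inE => /and3P [-> pL ->].
  by rewrite (subsetP (subL _)).
by exists f; split=> // i; exact: (subsetP (subL i)).
Qed.
End Transversal.

(** * Robust chains *)

Definition neighbours (T : finType) (r : rel T) (v : T) : {set T} := [set u | r v u].

Definition robustly_expanding (T : finType) (e : rel T) (h t : nat) : Prop :=
  forall X : {set T}, t <= #|X| -> #|X| + t <= #|T| ->
    #|X| + h <= #|[set v | h <= #|neighbours e v :&: X|]|.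

Lemma double_counting (A B : finType) (P : A -> B -> bool) :
  \sum_a #|[set b | P a b]| = \sum_b #|[set a | P a b]|.
Proof.
under eq_bigr do rewrite -sum1dep_card big_mkcond /=.
under [RHS]eq_bigr do rewrite -sum1dep_card big_mkcond /=.
exact: exchange_big.
Qed.

(* Abstracting the cardinals first keeps [lia] from comparing the underlying set
   expressions up to conversion. *)
Ltac card_lia :=
  repeat match goal with |- context [#|?A|] => let k := fresh in move: #|A| => k end; clear; lia.

Ltac card_nia :=
  repeat match goal with |- context [#|?A|] => let k := fresh in move: #|A| => k end; clear; nia.

Section Chain.
Variables (T K : finType) (e r : rel T) (c : T -> T -> K) (pi : {perm T}).
Variables (D h t d M l g m : nat) (Z : {set T}) (G : T -> {set T}).
Hypotheses (r_sym : symmetric r) (c_sym : forall x y, c x y = c y x).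
Hypotheses (h_gt0 : 0 < h) (n_le : #|T| <= D * h) (h_le_t : h <= t) (t_le_d : 4 * t <= d).
Hypothesis deg : forall v, d <= #|neighbours e v|.
Hypothesis robust : robustly_expanding e h t.
Hypothesis loss : forall v, v \notin Z -> #|neighbours e v :\: neighbours r v| <= l.
Hypothesis l_le : 2 * l <= h.
Hypothesis col_le : forall v k, #|[set u | r v u && (c v u == k)]| <= M.
Hypothesis cardZ : 2 * (#|Z| + 8 * D * M) <= h.
Hypothesis cardG : forall x, #|G x| <= g.
Variable x0 : T.
Hypothesis loss0 : #|neighbours e x0 :\: neighbours r x0| <= l.

(* From a vertex of [H] the last two edges of a chain to [x0] would often share their colour. *)
Let H := [set v | h <= 8 * #|[set a | [&& r a x0, r v (pi a) & c v (pi a) == c a x0]]|].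

Let card_H : #|H| <= 8 * D * M.
Proof.
pose P v a := [&& r a x0, r v (pi a) & c v (pi a) == c a x0].
have : h * #|H| <= h * (8 * D * M).
  apply: (@leq_trans (\sum_v 8 * #|[set a | P v a]|)).
    rewrite mulnC -sum_nat_const [X in _ <= X](bigID (mem H)) /= -[X in X <= _]addn0.
    by apply: leq_add => //; apply: leq_sum => v; rewrite inE.
  rewrite -big_distrr /= double_counting.
  apply: (@leq_trans (8 * (#|T| * M))).
    rewrite leq_mul2l /= -sum_nat_const; apply: leq_sum => a _.
    apply: leq_trans (col_le (pi a) (c a x0)); apply/subset_leq_card/subsetP => v.
    by rewrite !inE r_sym c_sym => /and3P [_ -> ->].
  by move: n_le; nia.
by rewrite leq_pmul2l.
Qed.

Let Z' := Z :|: H.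

Let card_Z' : 2 * #|Z'| <= h.
Proof. by apply: leq_trans cardZ; rewrite leq_mul2l /= (leq_trans (leq_card_setU _ _)) // leq_add2l. Qed.

(** A search backwards from [x0]: from [level j] one reaches [x0] by [j] hops [v -> pi a] and a last
    edge, with many choices at every hop. A robust neighbour offers at least [h] hops in [e], and
    passing to [r] destroys at most [l] of them, whence the threshold [h - l]. *)
Fixpoint level (j : nat) : {set T} :=
  if j is j'.+1 then [set v | v \notin Z' & h - l <= #|[set a in level j' | r v (pi a)]|]
  else [set a | a \notin Z' & r a x0].

Lemma card_hop (X : {set T}) v :
  #|[set a in X | r v (pi a)]| = #|neighbours r v :&: pi @: X|.
Proof.
rewrite -(card_imset _ (@perm_inj _ pi)); apply: eq_card => b.
apply/imsetP/setIP => [[a]|[]].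
  by rewrite !inE => /andP [aX rva] ->; split=> //; apply: imset_f.
by rewrite inE => rvb /imsetP [a aX bE]; exists a => //; rewrite inE aX -bE.
Qed.

Lemma level_notin j a : a \in level j -> a \notin Z'.
Proof. by case: j => [|j]; rewrite inE => /andP []. Qed.

Lemma card_neighbours_loss v (X : {set T}) :
  #|neighbours e v :\: neighbours r v| <= l ->
  #|neighbours e v :&: X| <= #|neighbours r v :&: X| + l.
Proof.
move=> lv; rewrite -(cardsID (neighbours r v) (neighbours e v :&: X)); apply: leq_add.
  by apply/subset_leq_card/subsetP => u; rewrite !inE => /andP [/andP [_ ->] ->].
apply: leq_trans lv; apply/subset_leq_card/subsetP => u.
by rewrite !inE => /andP [-> /andP [->]].
Qed.

Lemma d_le_n : d <= #|T|.
Proof. exact: leq_trans (deg x0) (max_card _). Qed.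

(** Expansion gains [h] vertices and the excluded set [Z'] costs at most [h / 2], so each level
    grows by at least [h / 2]. *)
Lemma level_step j (Y : {set T}) : Y \subset level j -> t <= #|Y| -> #|Y| + t <= #|T| ->
  2 * #|Y| + h <= 2 * #|level j.+1|.
Proof.
move=> subY tY Yt; have cY : #|pi @: Y| = #|Y| by rewrite card_imset //; exact: perm_inj.
have := robust; rewrite /robustly_expanding => /(_ (pi @: Y)); rewrite cY => /(_ tY Yt).
set N := [set v | _] => cN.
have sub : N :\: Z' \subset level j.+1.
  apply/subsetP => v /setDP [+ vZ]; rewrite in_set => hv; rewrite /= in_set vZ /= card_hop.
  have vZ0 : v \notin Z by apply: contra vZ; rewrite inE => ->.
  rewrite leq_subLR addnC; apply: leq_trans hv _.
  apply: leq_trans (card_neighbours_loss _ (loss vZ0)) _; rewrite leq_add2r.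
  exact/subset_leq_card/setIS/imsetS.
have := subset_leq_card sub; have := cardsD N Z'.
have : #|N :&: Z'| <= #|Z'| by apply/subset_leq_card/subsetIr.
by move: card_Z' cN; card_lia.
Qed.

Lemma card_level j :
  t <= #|level j| /\ (#|T| <= #|level j| + t \/ 2 * t + j * h <= 2 * #|level j|).
Proof.
elim: j => [|j [IHt IH]].
  suff : t <= #|level 0| by move=> ?; split=> //; right; lia.
  have := card_neighbours_loss [set: T] loss0; rewrite !setIT => h0.
  have : neighbours r x0 :\: Z' \subset level 0.
    by apply/subsetP => a; rewrite !inE r_sym => /andP [-> ->].
  move/subset_leq_card; have := cardsD (neighbours r x0) Z'.
  have : #|neighbours r x0 :&: Z'| <= #|Z'| by apply/subset_leq_card/subsetIr.
  have := deg x0; move: card_Z' l_le h_le_t t_le_d h0; card_lia.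
have [le|lt] := leqP (#|level j| + t) #|T|.
  by have := level_step (subxx _) IHt le; move: IHt IH; card_lia.
have dn := d_le_n.
(* This level is too large for the expansion hypothesis; a subset of size exactly [#|T| - t] is
   still admissible. *)
have [|Y subY cY] := @subset_of_card _ (level j) (#|T| - t); first by move: lt; card_lia.
by have := level_step subY; rewrite cY; move: dn h_le_t t_le_d; card_lia.
Qed.

(** After [2 * D] gains of [h / 2] the level misses at most [t] vertices, whereas [y] has at least
    [4 * t] neighbours. *)
Lemma hop_far j y : #|neighbours e y :\: neighbours r y| <= l -> 2 * D <= j ->
  h - l <= #|[set a in level j | r y (pi a)]|.
Proof.
move=> ly Dj; have [_ cj] := card_level j.
have {}cj : #|T| <= #|level j| + t by case: cj => // cj; move: n_le Dj cj; card_nia.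
rewrite card_hop; have cX : #|pi @: level j| = #|level j| by rewrite card_imset //; exact: perm_inj.
have := card_neighbours_loss (pi @: level j) ly.
have := cardsID (pi @: level j) (neighbours e y).
have : #|neighbours e y :\: pi @: level j| <= #|~: (pi @: level j)|.
  by apply/subset_leq_card/subsetP => u; rewrite !inE => /andP [].
by have := cardsC (pi @: level j); rewrite cX; have := deg y; move: h_le_t t_le_d l_le cj; card_lia.
Qed.

Lemma card_colours_in v (f : T -> T) (Q : seq K) : injective f ->
  #|[set a | r v (f a) && (c v (f a) \in Q)]| <= size Q * M.
Proof.
move=> f_inj; elim: Q => [|k Q IHQ]; first by rewrite eq_card0 // => a; rewrite !inE andbF.
apply: leq_trans (_ : #|[set a | r v (f a) && (c v (f a) == k)] :|: [set a | r v (f a) && (c v (f a) \in Q)]| <= _).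
  by apply/subset_leq_card/subsetP => a; rewrite !inE => /andP [-> /orP [] ->]; rewrite ?orbT.
apply: leq_trans (leq_card_setU _ _) _; rewrite mulSn; apply: leq_add => //.
rewrite -(card_imset _ f_inj); apply: leq_trans (col_le v k).
by apply/subset_leq_card/subsetP => _ /imsetP [a + ->]; rewrite !inE.
Qed.

Lemma card_spacing (p : seq T) : #|\bigcup_(x <- p) G x| <= g * size p.
Proof.
elim: p => [|x p IHp]; first by rewrite big_nil cards0.
by rewrite big_cons /= mulnS (leq_trans (leq_card_setU _ _)) // leq_add.
Qed.

(** Greedy choice. A hop has at least [h - l >= h / 2] candidates; the last one gives up less than
    [h / 8] of them to keep the colours of the two final edges apart, and [3 * h / 8] remain for the
    numerical hypothesis. The colours in [Q] count twice because the last vertex [a] determines two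
    edges, to [v] via [pi a] and to [x0]. *)
Let chain_from j : forall v (p : seq T) (Q : seq K),
  h - l <= #|[set a in level j | r v (pi a)]| -> (0 < j) || (v \notin H) ->
  8 * (g * (size p + j) + 2 * (size Q + j) * M) < 3 * h ->
  exists s : seq T,
    [/\ size s = j.+1, all [predC Z'] s, allrel (fun x a => a \notin G x) p s,
        pairwise (fun x a => a \notin G x) s &
     [/\ path (fun u a => r u (pi a)) v s, r (last v s) x0,
        uniq (rcons (pairmap (fun u a => c u (pi a)) v s) (c (last v s) x0)) &
        ~~ has (mem Q) (rcons (pairmap (fun u a => c u (pi a)) v s) (c (last v s) x0))]].
Proof.
elim: j => [|j IHj] v p Q hv jv hnum.
  pose X1 := \bigcup_(x <- p) G x.
  pose X2 := [set a | r v (pi a) && (c v (pi a) \in Q)].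
  pose X3 := [set a | r x0 a && (c x0 a \in Q)].
  pose X4 := [set a | [&& r a x0, r v (pi a) & c v (pi a) == c a x0]].
  have [a aL aX] : exists2 a, a \in [set a in level 0 | r v (pi a)] & a \notin X1 :|: X2 :|: X3 :|: X4.
    apply/subsetPn; apply/negP => /subset_leq_card.
    have c1 := card_spacing p; have c2 := card_colours_in v Q (@perm_inj _ pi).
    have c3 := card_colours_in x0 Q (@inj_id _).
    have c4 : 8 * #|X4| < h by move: jv; rewrite /= inE -ltnNge.
    have := card_setU_le (X1 :|: X2 :|: X3) X4; have := card_setU_le (X1 :|: X2) X3.
    have := card_setU_le X1 X2; move: hv hnum l_le c1 c2 c3 c4.
    rewrite -/X1 -/X2 -/X3; card_lia.
  move: aL; rewrite 2!inE => /andP [/andP [aZ rax0] rva].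
  move: aX; rewrite !inE !negb_or rax0 rva [r x0 a]r_sym rax0 [c x0 a]c_sym /=.
  move=> /andP [/andP [/andP [aX1 aQ1] aQ2] aa].
  exists [:: a]; split=> //=.
  - by rewrite aZ.
  - apply/allrelP => x b xp; rewrite inE => /eqP ->; apply: contra aX1 => aG.
    by rewrite /X1 (big_rem x) //= inE aG.
  - by split; rewrite /= ?rva ?andbT ?inE //= ?negb_or ?aQ1 ?aQ2.
pose X1 := \bigcup_(x <- p) G x.
pose X2 := [set a | r v (pi a) && (c v (pi a) \in Q)].
have [a aL aX] : exists2 a, a \in [set a in level j.+1 | r v (pi a)] & a \notin X1 :|: X2.
  apply/subsetPn; apply/negP => /subset_leq_card.
  have c1 := card_spacing p; have c2 := card_colours_in v Q (@perm_inj _ pi).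
  have := card_setU_le X1 X2; move: hv hnum l_le c1 c2; rewrite -/X1 -/X2; card_nia.
move: aL; rewrite inE => /andP [aL rva].
have aZ := level_notin aL; move: aL; rewrite inE => /andP [_ ha].
move: aX; rewrite !inE negb_or rva /= => /andP [aX1 aQ].
have [||s [sz sZ sp sG [s1 s2 s3 s4]]] := IHj a (a :: p) (c v (pi a) :: Q) ha.
(* Every vertex taken from a level avoids [Z'] and hence [H]; only the starting vertex may lie in
   [H], and the chain is long enough that it never makes the last hop. *)
- by apply/orP; right; apply: contra aZ; apply: (subsetP (subsetUr _ _)).
- by move: hnum => /=; rewrite !addnS !addSn.
move: sp; rewrite allrel_consl => /andP [saG sp].
exists (a :: s); split=> /=.
- by rewrite sz.
- by rewrite aZ.
- rewrite allrel_consr sp andbT; apply/allP => x xp; apply: contra aX1 => aG.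
  by rewrite /X1 (big_rem x) //= inE aG.
- by rewrite saG.
- split=> //=; first by rewrite rva.
    rewrite s3 andbT; apply/negP => /= h0; move/hasPn: s4 => /(_ _ h0).
    by rewrite /= inE eqxx.
  rewrite negb_or aQ /=; apply/hasPn => k /(hasPn s4); rewrite /= inE negb_or.
  by case/andP.
Qed.

(** Used in two ways: with [pi] the identity the chain is an ordinary path from [y] to [x0]; with
    [pi] a partial path cover and [x0 = pi y] it is a cyclic exchange of arcs. [G x] is the zone
    that later chain vertices must avoid once [x] has been taken. *)
Lemma chain_exists (y : T) (Q : seq K) : #|neighbours e y :\: neighbours r y| <= l ->
  0 < D -> 2 * D < m -> 8 * (g * m + 2 * (size Q + m) * M) < 3 * h ->
  exists s : seq T,
    [/\ size s = m, all [predC Z] s, pairwise (fun x a => a \notin G x) (y :: s),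
        path (fun u a => r u (pi a)) y s &
     [/\ r (last y s) x0,
        uniq (rcons (pairmap (fun u a => c u (pi a)) y s) (c (last y s) x0)) &
        ~~ has (mem Q) (rcons (pairmap (fun u a => c u (pi a)) y s) (c (last y s) x0))]].
Proof.
move=> ly D0 Dm hnum; case: m Dm hnum => // j; rewrite ltnS => Dj hnum.
have [||s [sz sZ sp sG [s1 s2 s3 s4]]] := @chain_from j y [:: y] Q (hop_far ly Dj).
- by apply/orP; left; lia.
- by apply: leq_ltn_trans hnum; rewrite leq_mul2l /= leq_add // !leq_mul //=; lia.
exists s; split=> //=.
- by apply: sub_all sZ => a; rewrite /= inE negb_or => /andP [].
- by rewrite sG andbT; move: sp; rewrite allrel_consl => /andP [->].
Qed.

End Chain.

(** * Rotors *)

Lemma eq_pairmap (S1 S2 : Type) (f g : S1 -> S1 -> S2) x s :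
  (forall a b, f a b = g a b) -> pairmap f x s = pairmap g x s.
Proof. by move=> fg; elim: s x => //= a s IHs x; rewrite fg IHs. Qed.

Lemma pairmap_rcons (S1 S2 : Type) (f : S1 -> S1 -> S2) x s y :
  pairmap f x (rcons s y) = rcons (pairmap f x s) (f (last x s) y).
Proof. by rewrite -cats1 pairmap_cat cats1. Qed.

Lemma pairmap_rev (S1 S2 : Type) (f : S1 -> S1 -> S2) x s y :
  (forall a b, f a b = f b a) ->
  pairmap f y (rcons (rev s) x) = rev (pairmap f x (rcons s y)).
Proof.
move=> f_sym; elim: s x => [|a s IHs] x /=; first by rewrite f_sym.
by rewrite rev_cons pairmap_rcons IHs last_rcons rev_cons f_sym.
Qed.

Lemma path_rev (T : Type) (r : rel T) x s y : symmetric r ->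
  path r y (rcons (rev s) x) = path r x (rcons s y).
Proof.
move=> r_sym; elim: s x => [|a s IHs] x /=; first by rewrite r_sym.
by rewrite rev_cons rcons_path IHs last_rcons r_sym andbC.
Qed.

Lemma pairmap_rev_belast (S1 S2 : Type) (f : S1 -> S1 -> S2) x s :
  (forall a b, f a b = f b a) ->
  pairmap f (last x s) (rev (belast x s)) = rev (pairmap f x s).
Proof.
move=> f_sym; case/lastP: s => // s y.
by rewrite last_rcons belast_rcons rev_cons pairmap_rev.
Qed.

Lemma path_rev_belast (T : Type) (r : rel T) x s : symmetric r ->
  path r (last x s) (rev (belast x s)) = path r x s.
Proof. by move=> r_sym; rewrite rev_path; apply: eq_path => a b; rewrite r_sym. Qed.

Lemma uniq_cat_insert (S : eqType) (X Y W : seq S) :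
  uniq (X ++ W) -> uniq Y -> (forall k, k \in Y -> k \notin X ++ W) -> uniq (X ++ Y ++ W).
Proof.
move=> uXW uY YXW; rewrite uniq_catCA cat_uniq uY uXW andbT.
by apply/hasPn => k kXW; apply/negP => kY; move: (YXW k kY); rewrite kXW.
Qed.

Section Rotor.
Variables (T K : finType) (e r : rel T) (c : T -> T -> K).
Variables (D h t d M l B m : nat) (Z : {set T}).
Hypotheses (r_sym : symmetric r) (c_sym : forall x y, c x y = c y x).
Hypotheses (h_gt0 : 0 < h) (n_le : #|T| <= D * h) (h_le_t : h <= t) (t_le_d : 4 * t <= d).
Hypothesis deg : forall v, d <= #|neighbours e v|.
Hypothesis robust : robustly_expanding e h t.
Hypothesis loss : forall v, v \notin Z -> #|neighbours e v :\: neighbours r v| <= l.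
Hypothesis l_le : 2 * l <= h.
Hypothesis col_le : forall v k, #|[set u | r v u && (c v u == k)]| <= M.
Hypothesis cardZ : 2 * (#|Z| + B + 8 * D * M) <= h.
Hypotheses (D_gt0 : 0 < D) (D_lt_m : 2 * D < m) (hnum : 8 * (m + 2 * (B + m) * M) < 3 * h).

(** A chain for the identity permutation with [G x = [set x]]: spacing then just means distinct
    vertices. The vertices to avoid join the excluded set. *)
Lemma connect (W : seq T) (Q : seq K) u w :
  size W + 2 <= B -> size Q <= B ->
  #|neighbours e u :\: neighbours r u| <= l -> #|neighbours e w :\: neighbours r w| <= l ->
  exists C : seq T,
    [/\ size C = m, all [predC Z] C, uniq C, all [predC u :: w :: W] C &
     [/\ path r u (rcons C w), uniq (pairmap c u (rcons C w)) &
        ~~ has (mem Q) (pairmap c u (rcons C w))]].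
Proof.
move=> sW sQ lu lw; pose ZW := Z :|: [set x in u :: w :: W].
have cardZW : 2 * (#|ZW| + 8 * D * M) <= h.
  apply: leq_trans cardZ; rewrite leq_mul2l /= leq_add2r.
  apply: leq_trans (card_setU_le _ _) _; rewrite leq_add2l cardsE.
  by apply: leq_trans (card_size _) _; rewrite /= -addn2.
have lossZW v : v \notin ZW -> #|neighbours e v :\: neighbours r v| <= l.
  by rewrite inE negb_or => /andP [/loss].
have cardG (x : T) : #|[set x]| <= 1 by rewrite cards1.
have [|s [sz sZ sG sp [s1 s2 s3]]] := @chain_exists T K e r c 1%g D h t d M l 1 m ZW
  (fun x => [set x]) r_sym c_sym h_gt0 n_le h_le_t t_le_d deg robust lossZW l_le col_le
  cardZW cardG w lw u Q lu D_gt0 D_lt_m.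
  apply: leq_ltn_trans hnum; rewrite mul1n leq_mul2l /= leq_add2l leq_mul2r; apply/orP; right.
  by rewrite leq_mul2l leq_add2r sQ orbT.
have perm1E x y : c x ((1 : {perm T})%g y) = c x y by rewrite perm1.
have colE : pairmap c u (rcons s w) =
    rcons (pairmap (fun u a => c u ((1 : {perm T})%g a)) u s) (c (last u s) w).
  by rewrite pairmap_rcons; congr rcons; apply: eq_pairmap => a b; rewrite perm1E.
exists s; split=> //.
- by apply: sub_all sZ => a; rewrite /= inE negb_or => /andP [].
- move: sG; rewrite /= uniq_pairwise => /andP [_].
  by apply: sub_pairwise => x y /=; rewrite inE eq_sym.
- by apply: sub_all sZ => a; rewrite /= !inE !negb_or => /andP [].
- rewrite colE; split=> //; rewrite rcons_path s1 andbT.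
  by rewrite -(eq_path (e := fun u a => r u ((1 : {perm T})%g a))) // => x y; rewrite perm1.
Qed.

(* A path [y ... x] with [y] adjacent to [s] and [x] adjacent to [z] is absorbed by replacing
   [s :: V] with [s :: (y ... x) ++ z :: R]. *)
Definition rotor (rr : rel T) (s : T) (V : seq T) (z : T) (R : seq T) : Prop :=
  [/\ path rr s V, path rr z R, perm_eq V (z :: R), last s V = last z R &
      uniq (pairmap c s V) /\ uniq (pairmap c z R)].

(* A two-step walk [z, q, p] moves the exit from [z] to [p]: with [C] linking [last s V] to
   [p], the path [V ++ C ++ [:: p; q]] also reads, from [p] to [q], as
   [p :: rev C ++ rev (z :: R) ++ [:: q]]. *)
Lemma rotor_extend k s V z R w :
  size w = k.*2 -> path r z w -> rotor r s V z R -> uniq (s :: V ++ w) ->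
  uniq (pairmap c s V ++ pairmap c z w) -> uniq (pairmap c z R ++ pairmap c z w) ->
  all [predC Z] (s :: V ++ w) -> 2 * size V + k * (2 * (m + 2)) + 3 <= B ->
  exists V' R', [/\ rotor r s V' (last z w) R', uniq (s :: V'), all [predC Z] V' &
     size V' = size V + k * (m + 2)].
Proof.
elim: k s V z R w => [|k IHk] s V z R w sw pw rot uV uVw uRw nZ sB.
  case: w sw pw uV uVw uRw nZ => //= _ _; rewrite !cats0 => uV _ _ /andP [_ nZ].
  by exists V, R; split=> //; rewrite mul0n addn0.
have [pV pR VR lVR [ucV ucR]] := rot.
case: w sw pw uV uVw uRw nZ => // q [//|p w] sw pw uV uVw uRw nZ.
have V0 : V != [::] by move: (perm_size VR); case: (V).
have pZ : p \notin Z.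
  by have /allP/(_ p) := nZ; apply; rewrite !inE mem_cat !inE eqxx !orbT.
have tZ : last s V \notin Z.
  by have /allP/(_ (last s V)) := nZ; apply; rewrite -cat_cons mem_cat mem_last.
have swk : size w = k.*2 by move: sw; rewrite doubleS => -[].
have sV : size V = (size R).+1 by rewrite (perm_size VR).
(* The link will occur in both new readings, next to the edges of either old reading and of the
   walk, so it has to avoid the colours of all three. *)
have [||C [sC CZ uC Cn [pC ucC Cq]]] := @connect (s :: V ++ q :: p :: w)
   (pairmap c s V ++ pairmap c z R ++ pairmap c z (q :: p :: w)) (last s V) p _ _ (loss tZ) (loss pZ).
- by rewrite /= size_cat /= swk; move: sB; clear; nia.
- by rewrite !size_cat !size_pairmap /= swk; move: sB sV; clear; nia.
move: pw => /= /and3P [rzq rqp pw].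
have Cn' a : a \in C -> a \notin s :: V ++ q :: p :: w.
  by move=> /(allP Cn); rewrite /= in_cons negb_or => /andP [_]; rewrite in_cons negb_or => /andP [].
have sub : [/\ all [predC s :: V] C, all [predC w] C, q \notin C & p \notin C].
  split.
  - apply/allP => a aC; apply: contra (Cn' a aC) => aV.
    by rewrite -cat_cons mem_cat; apply/orP; left.
  - apply/allP => a aC; apply: contra (Cn' a aC) => aw.
    by rewrite -cat_cons mem_cat !in_cons; apply/or4P; constructor 4.
  - by apply/negP => aC; have := Cn' _ aC; rewrite -cat_cons mem_cat !inE eqxx !orbT.
  - by apply/negP => aC; have := Cn' _ aC; rewrite -cat_cons mem_cat !inE eqxx !orbT.
have [CV Cw qC pC'] := sub.
have Cq' k' : k' \in pairmap c (last s V) (rcons C p) ->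
   [/\ k' \notin pairmap c s V, k' \notin pairmap c z R & k' \notin pairmap c z (q :: p :: w)].
  by move=> /(hasPn Cq); rewrite /= !mem_cat !negb_or => /and3P [].
pose V' := V ++ rcons C p ++ [:: q].
pose R' := rcons (rev C) (last s V) ++ rev (belast z R) ++ [:: q].
have revR : rcons (rev C) (last s V) ++ rev (belast z R) = rev C ++ rev (z :: R).
  by rewrite lastI rev_rcons lVR cat_rcons.
have lastR' : last p (rcons (rev C) (last s V) ++ rev (belast z R)) = z.
  by rewrite revR rev_cons last_cat last_rcons.
have ucV' : uniq (pairmap c s V' ++ pairmap c p w).
  rewrite /V' !pairmap_cat last_rcons /= -!catA; apply: uniq_cat_insert => //.
    apply: subseq_uniq uVw; rewrite c_sym cat_subseq //.
    exact: subseq_cons.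
  move=> k' /Cq' [k1 _]; rewrite /= !inE !negb_or => /and3P [_ kqp kw].
  by rewrite mem_cat !inE !negb_or k1 [c p q]c_sym kqp.
have ucR' : uniq (pairmap c p R' ++ pairmap c p w).
  rewrite /R' catA pairmap_cat lastR' /= lVR pairmap_cat last_rcons pairmap_rev //.
  rewrite pairmap_rev_belast // -lVR -!catA; apply: (@uniq_cat_insert _ [::]).
  - rewrite cat0s; apply: (@subseq_uniq _ _ (rev (pairmap c z R) ++ pairmap c z (q :: p :: w))).
      apply: cat_subseq => //.
      exact: (cat_subseq (subseq_refl [:: c z q]) (subseq_cons _ _)).
    have /perm_uniq -> // : perm_eq (rev (pairmap c z R) ++ pairmap c z (q :: p :: w))
        (pairmap c z R ++ pairmap c z (q :: p :: w)).
    by rewrite perm_cat2r perm_rev.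
  - by rewrite rev_uniq.
  move=> k'; rewrite mem_rev => /Cq' [_ k2]; rewrite /= !inE !negb_or => /and3P [kzq _ kw].
  by rewrite mem_cat mem_rev !inE !negb_or k2 kzq.
have [||||||V2 [R2 [rot2 u2 Z2 s2]]] := IHk s V' p R' w swk pw.
- split.
  + by rewrite /V' !cat_path pV pC last_rcons /= r_sym rqp.
  + rewrite /R' catA cat_path lastR' /= rzq andbT cat_path last_rcons lVR.
    by rewrite path_rev_belast // pR path_rev // -lVR pC.
  + rewrite /R' catA revR; apply/seq.permP => P; have := seq.permP VR P.
    by rewrite /V' /= -cats1 !count_cat /= !count_rev /=; clear; lia.
  + by rewrite /V' /R' !last_cat.
  + by have := cat_uniq (pairmap c s V') (pairmap c p w); rewrite ucV' => /esym/and3P [-> _ _];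
     have := cat_uniq (pairmap c p R') (pairmap c p w); rewrite ucR' => /esym/and3P [-> _ _].
- have : perm_eq (s :: V' ++ w) (C ++ s :: V ++ q :: p :: w).
    by apply/seq.permP => P; rewrite /V' /= -cats1 /= !count_cat /= !count_cat /=; clear; lia.
  move/perm_uniq ->; rewrite cat_uniq uC uV andbT andTb.
  by apply/hasPn => a aW; apply/negP => /Cn'; rewrite aW.
- exact: ucV'.
- exact: ucR'.
- by move: nZ; rewrite /V' /= !all_cat /= all_rcons CZ /= => /andP [-> /and4P [-> -> -> ->]].
- by rewrite /V' !size_cat size_rcons /= sC; move: sB; clear; nia.
exists V2, R2; split=> //; rewrite s2 /V' !size_cat size_rcons /= sC; clear; nia.
Qed.

(** The trivial rotor consists of one vertex [u] next to [s], with [u] as its own exit. Its exit is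
    then slid along a link from [s] through [u] to [z]. A slide consumes two vertices, which is why
    [m] is even: [m = D.+1.*2] allows [D.+1] slides, each adding [m + 2] vertices. *)
Lemma rotor_exists s z : m = D.+1.*2 ->
  (D.+1) * (2 * (m + 2)) + 5 <= B -> s != z -> s \notin Z -> z \notin Z ->
  exists V R, [/\ rotor r s V z R, uniq (s :: V), all [predC Z] V &
     size V = 1 + D.+1 * (m + 2)].
Proof.
move=> mE sB sz sZ zZ.
have [||C [sC CZ uC Cn [pC ucC _]]] := @connect [::] [::] s z _ _ (loss sZ) (loss zZ).
- by rewrite /=; move: sB; clear; nia.
- by [].
case: C sC CZ uC Cn pC ucC => [|u w] sC CZ uC Cn pC ucC; first by move: sC D_lt_m => <-.
have [||||||||V [R [rot uV VZ sV]]] := @rotor_extend D.+1 s [:: u] u [::] (rcons w z).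
- by rewrite size_rcons; move: sC => /= ->.
- by move: pC => /= /andP [].
- by move: pC => /= /andP [su _]; split; rewrite /= ?su.
- move: uC Cn => /= /andP [uw uniqw] /andP [].
  rewrite !inE !negb_or => /andP [us uz] /allP wn.
  have sw : s \notin w by apply/negP => /wn; rewrite /= !inE eqxx.
  have zw : z \notin w by apply/negP => /wn; rewrite /= !inE eqxx orbT.
  rewrite ?in_cons !mem_rcons !in_cons !negb_or rcons_uniq.
  by rewrite [s == u]eq_sym us sz sw uz uw zw.
- by move: ucC.
- by move: ucC => /= /andP [].
- by rewrite /= sZ all_rcons /= zZ /=; move: CZ => /= /andP [-> ->].
- by rewrite /=; move: sB; clear; nia.
by exists V, R; move: rot; rewrite last_rcons sV.
Qed.

End Rotor.

(** * The absorbing path *)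

Lemma expnS_bernoulli a : 2 * a ^ a.+1 <= a.+1 ^ a.+1.
Proof.
have bern k : a ^ k.+1 + k.+1 * a ^ k <= a.+1 ^ k.+1.
  elim: k => [|k IHk]; first by rewrite !expn1 expn0; lia.
  rewrite [a.+1 ^ _]expnS; apply: leq_trans (leq_mul (leqnn a.+1) IHk).
  rewrite [a ^ k.+2]expnS [a ^ k.+1]expnS; nia.
apply: leq_trans (bern a); rewrite [a ^ a.+1]expnS; nia.
Qed.

(** Here [k] is to be the number of blocks absorbing a fixed pair, out of [4 * q * j]. By Bernoulli,
    [(1 - 1 / (2q)) ^ (2q) <= 1 / 2], so the potential has shrunk by a factor [2 ^ (2j)] against
    pure doubling; one factor [2 ^ j] pays for the initial value [x], the other forces [j <= k]. *)
Lemma potential_bound (q j k x : nat) : 0 < q -> x <= 2 ^ j ->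
  q ^ (4 * q * j) * 2 ^ (4 * q * j - k) <= (2 * q - 1) ^ (4 * q * j) * x -> 
  k <= 4 * q * j -> j <= k.
Proof.
case: (posnP j) => [-> //|j0] q0 xj; set N := 4 * q * j => hq kN.
have [a aE] : exists a, 2 * q = a.+1 by exists (2 * q).-1; lia.
have NE : N = (2 * j) * a.+1 by rewrite /N -aE; clear; nia.
have h1 : 2 ^ (2 * j) * a ^ N <= a.+1 ^ N.
  have E b : b ^ N = (b ^ a.+1) ^ (2 * j) by rewrite NE mulnC expnM.
  by rewrite !E -expnMn leq_exp2r ?expnS_bernoulli // muln_gt0.
have h2 : (2 * q) ^ N <= a ^ N * 2 ^ (j + k).
  have E : (2 * q) ^ N = q ^ N * 2 ^ (N - k) * 2 ^ k.
    by rewrite expnMn -mulnA -expnD subnK // mulnC.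
  rewrite E expnD mulnA leq_mul2r; apply/orP; right; apply: leq_trans hq _.
  by rewrite aE subn1 /= leq_mul2l xj orbT.
rewrite aE in h2; have := leq_trans h1 h2.
have a0 : 0 < a by lia.
rewrite [a ^ N * _]mulnC leq_pmul2r ?expn_gt0 ?a0 // leq_exp2l //; lia.
Qed.

Lemma weighted_pigeonhole (A B : finType) (ok : A -> B -> bool) (w : A -> nat) (X : {set B}) (a q : nat) :
  0 < a -> 0 < \sum_p w p -> (forall p, a <= #|[set b in X | ok p b]|) -> #|X| <= q * a -> 0 < q ->
  exists2 b, b \in X & \sum_p w p <= q * \sum_(p | ok p b) w p.
Proof.
move=> a0 w0 Xa Xq q0; apply/exists_inP; rewrite -[X in is_true X]negbK negb_exists.
apply/negP => /forallP small.
have h1 : a * \sum_p w p <= \sum_(b in X) \sum_(p | ok p b) w p.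
  rewrite big_distrr /=; under [X in _ <= X]eq_bigr do rewrite big_mkcond /=.
  rewrite exchange_big /=; apply: leq_sum => p _.
  apply: leq_trans (leq_mul (Xa p) (leqnn (w p))) _.
  rewrite -sum_nat_const big_mkcond [X in _ <= X]big_mkcond /=; apply: leq_sum => b _.
  by rewrite inE; case: (b \in X) => //=; case: ifP.
have h2 : q * (a * \sum_p w p) <= q * (a * (\sum_p w p).-1).
  apply: leq_trans (_ : #|X| * (\sum_p w p).-1 <= _); last by rewrite mulnA leq_mul2r Xq orbT.
  apply: leq_trans (leq_mul (leqnn q) h1) _; rewrite big_distrr /= -sum_nat_const.
  apply: leq_sum => b bX; have := small b; rewrite bX /= -ltnNge; case: (\sum_p w p) => // k.
by move: h2; rewrite !leq_pmul2l // leqNgt prednK ?leqnn.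
Qed.

(* A rotor [(b_start, b_path, b_exit, b_rest)] followed by the link to the next block. *)
Record block (T : Type) := Block
  { b_start : T; b_path : seq T; b_exit : T; b_rest : seq T; b_link : seq T }.

Definition block_tuple (T : Type) (b : block T) :=
  (b_start b, b_path b, b_exit b, b_rest b, b_link b).
Definition tuple_block (T : Type) (u : T * seq T * T * seq T * seq T) :=
  let: (s, V, z, R, C) := u in Block s V z R C.
Lemma block_tupleK (T : Type) : cancel (@block_tuple T) (@tuple_block T).
Proof. by case. Qed.
HB.instance Definition _ (T : eqType) := Equality.copy (block T) (can_type (@block_tupleK T)).

Section AbsorbingPath.
Variables (T K : finType) (e : rel T) (c : T -> T -> K) (U : {set K}).
Variables (D h t d M : nat).
Hypotheses (e_sym : symmetric e) (c_sym : forall x y, c x y = c y x).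
Hypotheses (h_gt0 : 0 < h) (n_le : #|T| <= D * h) (h_le_t : h <= t) (t_le_d : 4 * t <= d).
Hypothesis deg : forall v, d <= #|neighbours e v|.
Hypothesis robust : robustly_expanding e h t.
Hypothesis col_le : forall k, #|[set p : T * T | e p.1 p.2 && (c p.1 p.2 == k)]| <= M.
Hypothesis U_small : forall v, 4 * #|[set u | e v u && (c v u \in U)]| <= h.

Definition unreserved : rel T := fun x y => e x y && (c x y \notin U).
Definition fresh (S : seq K) : rel T := fun x y => unreserved x y && (c x y \notin S).
Definition lost (S : seq K) v := #|[set u | unreserved v u && (c v u \in S)]|.
(** The threshold [h / 8] is half of what [fresh_loss] tolerates: a start is unspoiled when chosen,
    and the colours of its own block are used up only afterwards. *)
Definition spoiled (S : seq K) := [set v | h < 8 * lost S v].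

Lemma fresh_sym S : symmetric (fresh S).
Proof. by move=> x y; rewrite /fresh /unreserved e_sym c_sym. Qed.

Lemma colour_degree v k : #|[set u | e v u && (c v u == k)]| <= M.
Proof.
have inj : injective (fun u : T => (v, u)) by move=> x y [].
rewrite -(card_imset _ inj); apply: leq_trans (col_le k).
by apply/subset_leq_card/subsetP => _ /imsetP [u + ->]; rewrite !inE.
Qed.

Lemma fresh_colour_degree S v k : #|[set u | fresh S v u && (c v u == k)]| <= M.
Proof.
apply: leq_trans (colour_degree v k); apply/subset_leq_card/subsetP => u.
by rewrite !inE => /andP [/andP [/andP [-> _] _] ->].
Qed.

Lemma unreserved_colour_degree v k : #|[set u | unreserved v u && (c v u == k)]| <= M.
Proof.
apply: leq_trans (colour_degree v k); apply/subset_leq_card/subsetP => u.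
by rewrite !inE => /andP [/andP [-> _] ->].
Qed.

Lemma fresh_loss S v : 8 * lost S v <= 2 * h ->
  #|neighbours e v :\: neighbours (fresh S) v| <= h./2.
Proof.
move=> lv; have sub : neighbours e v :\: neighbours (fresh S) v \subset
    [set u | e v u && (c v u \in U)] :|: [set u | unreserved v u && (c v u \in S)].
  apply/subsetP => u; rewrite !inE /fresh /unreserved => /andP [+ evu]; rewrite evu /=.
  by case: (c v u \in U); case: (c v u \in S).
have := leq_trans (subset_leq_card sub) (card_setU_le _ _).
rewrite geq_half_double -muln2; have := U_small v; move: lv; rewrite /lost; card_lia.
Qed.

Lemma lost_cat S1 S2 v : lost (S1 ++ S2) v <= lost S1 v + size S2 * M.
Proof.
have := @card_colours_in T K unreserved c M unreserved_colour_degree v id S2 (@inj_id _).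
move=> /(leq_add (leqnn (lost S1 v))); apply: leq_trans.
apply: leq_trans (card_setU_le _ _); apply/subset_leq_card/subsetP => u.
by rewrite !inE mem_cat => /andP [-> ->].
Qed.

Lemma sum_lost S : \sum_v lost S v <= size S * M.
Proof.
elim: S => [|k S IHS].
  rewrite big1 // => v _; rewrite /lost eq_card0 // => u; rewrite !inE andbF //.
apply: (@leq_trans (\sum_v (#|[set u | e v u && (c v u == k)]| + lost S v))).
  apply: leq_sum => v _; apply: leq_trans (card_setU_le _ _).
  apply/subset_leq_card/subsetP => u; rewrite !inE /unreserved.
  by case/andP => [/andP [-> ->]] /orP [] ->; rewrite ?orbT.
rewrite big_split /= mulSn; apply: leq_add IHS.
apply: leq_trans (col_le k); under eq_bigr do rewrite -sum1dep_card.
by rewrite pair_big_dep /= sum1dep_card.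
Qed.

(** A colour contributes at most [M] to the total loss, which is therefore at most
    [2 * #|T| * M <= 2 * D * h * M], while each spoiled vertex accounts for more than [h / 8] of
    it. *)
Lemma card_spoiled S : size S <= 2 * #|T| -> #|spoiled S| <= 16 * D * M.
Proof.
move=> sS; rewrite -(leq_pmul2l h_gt0).
apply: (@leq_trans (8 * \sum_v lost S v)).
  rewrite big_distrr mulnC -sum_nat_const [X in _ <= X](bigID (mem (spoiled S))) /=.
  rewrite -[X in X <= _]addn0; apply: leq_add => //; apply: leq_sum => v.
  by rewrite inE => /ltnW.
apply: leq_trans (leq_mul (leqnn 8) (sum_lost S)) _.
by move: n_le sS; card_nia.
Qed.

Let m := D.+1.*2.
(** With [m = D.+1.*2]: one start, [1 + D.+1 * (m + 2)] rotor vertices and a link of [m]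
    vertices. *)
Definition block_size := D.+1 * (D.+1.*2 + 2) + D.+1.*2 + 2.
Let B := 2 * block_size + 5.

Lemma block_exists (W : seq T) (S : seq K) (x s z : T) :
  0 < D -> size S <= 2 * #|T| -> 2 * (size W + B + 24 * D * M) <= h ->
  8 * (m + 2 * (B + m) * M) < 3 * h ->
  8 * lost S x <= 2 * h -> s != z -> s \notin W -> z \notin W ->
  s \notin spoiled S -> z \notin spoiled S ->
  exists b : block T,
    [/\ b_start b = s, b_exit b = z, rotor c (fresh S) s (b_path b) z (b_rest b),
        path (fresh S) (last s (b_path b)) (rcons (b_link b) x) &
     [/\ uniq (s :: b_path b ++ b_link b), all [predC W] (b_path b ++ b_link b),
         size (b_path b) = 1 + D.+1 * (m + 2) & size (b_link b) = m] /\
     let Y := pairmap c (last s (b_path b)) (rcons (b_link b) x) in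
     uniq (pairmap c s (b_path b) ++ Y) /\ uniq (pairmap c z (b_rest b) ++ Y)].
Proof.
move=> D0 sS hZ hnum lx sz sW zW sb zb; pose Z := [set v in W] :|: spoiled S.
have cZ : 2 * (#|Z| + B + 8 * D * M) <= h.
  have := card_setU_le [set v in W] (spoiled S); have := card_spoiled sS.
  have : #|[set v in W]| <= size W by rewrite cardsE card_size.
  by move: hZ; rewrite -/Z; clear; move: #|Z| #|_| #|_| => ? ? ?; nia.
have lossZ v : v \notin Z -> #|neighbours e v :\: neighbours (fresh S) v| <= h./2.
  by rewrite !inE negb_or -leqNgt => /andP [_ lv]; apply: fresh_loss; lia.
have l2 : 2 * h./2 <= h by rewrite mul2n -[X in _ <= X]odd_double_half leq_addl.
have Dm : 2 * D < m by rewrite /m; lia.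
have zs v : v \notin W -> v \notin spoiled S -> v \notin Z by rewrite !inE negb_or => -> ->.
have [|V [R [rot uV VZ sV]]] := @rotor_exists T K e (fresh S) c D h t d M h./2 B m Z
  (fresh_sym S) c_sym h_gt0 n_le h_le_t t_le_d deg robust lossZ l2 (fresh_colour_degree S)
  cZ D0 Dm hnum s z erefl _ sz (zs s sW sb) (zs z zW zb).
  by rewrite /B /block_size -/m; clear; nia.
have [pV pR VR lV [ucV ucR]] := rot.
have tZ : last s V \notin Z.
  have := mem_last s V; rewrite inE => /orP [/eqP ->|tV]; first exact: zs.
  exact: (allP VZ).
have sR : size R = D.+1 * (m + 2) by have := perm_size VR; rewrite sV /= => -[].
have [||C [sC CZ uC Cn [pC ucC Cq]]] := @connect T K e (fresh S) c D h t d M h./2 B m Z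
  (fresh_sym S) c_sym h_gt0 n_le h_le_t t_le_d deg robust lossZ l2 (fresh_colour_degree S)
  cZ D0 Dm hnum (s :: V) (pairmap c s V ++ pairmap c z R) (last s V) x _ _ (lossZ _ tZ)
  (fresh_loss lx).
- by rewrite /= sV /B /block_size -/m; clear; nia.
- by rewrite size_cat !size_pairmap sV sR /B /block_size -/m; clear; nia.
have WZ A : all [predC Z] A -> all [predC W] A.
  by apply: sub_all => a; rewrite /= !inE negb_or => /andP [].
have uVC : uniq (s :: V ++ C).
  rewrite -cat_cons cat_uniq uV uC andbT; apply/hasPn => a /(allP Cn) aV.
  by apply: contra aV; rewrite /= !inE => /orP [] ->; rewrite !orbT.
have VCW : all [predC W] (V ++ C) by rewrite all_cat !WZ.
have Cq' k : k \in pairmap c (last s V) (rcons C x) ->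
   (k \notin pairmap c s V) && (k \notin pairmap c z R).
  by move/(hasPn Cq); rewrite /= mem_cat negb_or.
have uQ X : uniq X -> (forall k, k \in pairmap c (last s V) (rcons C x) -> k \notin X) ->
    uniq (X ++ pairmap c (last s V) (rcons C x)).
  by move=> uX CX; rewrite cat_uniq uX ucC andbT; apply/hasPn.
exists (Block s V z R C); split=> //; split; first by split.
by split; apply: uQ => // k /Cq' /andP [].
Qed.

Definition reserved : rel T := fun x y => e x y && (c x y \in U).
Definition b_vertices (b : block T) := b_start b :: b_path b ++ b_link b.
(** The absorbing path ends in the fixed vertex [x] and grows by prepending blocks, so its first
    vertex is the one that changes. *)
Definition entry (x : T) (bs : seq (block T)) := head x (map (@b_start T) bs).
Definition vertices (x : T) (bs : seq (block T)) := flatten (map b_vertices bs) ++ [:: x].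
Definition link_colours (b : block T) (x : T) :=
  pairmap c (last (b_start b) (b_path b)) (rcons (b_link b) x).
(** Both readings of the rotor are charged, since only the final assembly decides which of them is
    traversed. They may share colours with each other, and [block_ok] makes each of them rainbow
    separately. *)
Definition b_colours (b : block T) (x : T) :=
  pairmap c (b_start b) (b_path b) ++ pairmap c (b_exit b) (b_rest b) ++ link_colours b x.
Fixpoint all_colours (x : T) (bs : seq (block T)) : seq K :=
  if bs is b :: bs' then all_colours x bs' ++ b_colours b (entry x bs') else [::].
Definition block_ok (b : block T) (x : T) : Prop :=
  [/\ rotor c unreserved (b_start b) (b_path b) (b_exit b) (b_rest b),
      path unreserved (last (b_start b) (b_path b)) (rcons (b_link b) x),
      uniq (pairmap c (b_start b) (b_path b) ++ link_colours b x) &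
      uniq (pairmap c (b_exit b) (b_rest b) ++ link_colours b x)].
Fixpoint absorber (x : T) (bs : seq (block T)) : Prop :=
  if bs is b :: bs' then
    [/\ block_ok b (entry x bs'), ~~ has (mem (all_colours x bs')) (b_colours b (entry x bs')) &
       absorber x bs']
  else True.
Definition absorbs (p : T * T) (b : block T) :=
  [&& reserved p.1 (b_start b), reserved p.2 (b_exit b) &
      c p.1 (b_start b) != c p.2 (b_exit b)].

Lemma path_fresh_colours S x s : path (fresh S) x s ->
  path unreserved x s /\ forall k, k \in pairmap c x s -> k \notin S.
Proof.
elim: s x => //= y s IHs x /andP [/andP [xy xyS] /IHs [-> IH]]; rewrite xy; split=> // k.
by rewrite inE => /orP [/eqP ->|/IH].
Qed.

Lemma card_pairs (P : T -> T -> bool) :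
  #|[set p : T * T | P p.1 p.2]| = \sum_x #|[set y | P x y]|.
Proof. by under eq_bigr do rewrite -sum1dep_card; rewrite pair_big_dep /= sum1dep_card. Qed.

(** Choose [s] first; then [z] has to avoid [W], [s] and the at most [M] neighbours of [p.2] along
    the colour of the edge from [p.1] to [s]. *)
Lemma good_pairs (W : {set T}) (a : nat) (p : T * T) :
  (forall v, a + #|W| + 1 + M <= #|[set u | reserved v u]|) ->
  a * a <= #|[set sz in [set sz : T * T | [&& sz.1 \notin W, sz.2 \notin W & sz.1 != sz.2]] |
      [&& reserved p.1 sz.1, reserved p.2 sz.2 & c p.1 sz.1 != c p.2 sz.2]]|.
Proof.
move=> resW.
pose P s z := [&& s \notin W, z \notin W & s != z] &&
  [&& reserved p.1 s, reserved p.2 z & c p.1 s != c p.2 z].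
have -> : #|[set sz in [set sz : T * T | [&& sz.1 \notin W, sz.2 \notin W & sz.1 != sz.2]] |
      [&& reserved p.1 sz.1, reserved p.2 sz.2 & c p.1 sz.1 != c p.2 sz.2]]| =
    #|[set sz : T * T | P sz.1 sz.2]| by apply: eq_card => sz; rewrite !inE.
rewrite card_pairs; pose A := [set s | reserved p.1 s] :\: W.
have cA : a <= #|A|.
  have := cardsD [set s | reserved p.1 s] W; have := resW p.1; rewrite -/A.
  have : #|[set s | reserved p.1 s] :&: W| <= #|W| by apply/subset_leq_card/subsetIr.
  card_lia.
apply: leq_trans (leq_mul cA (leqnn a)) _; rewrite -sum_nat_const.
rewrite [X in _ <= X](bigID (mem A)) /= -[X in X <= _]addn0; apply: leq_add => //.
apply: leq_sum => s; rewrite !inE => /andP [sW rs].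
pose X := W :|: [set s] :|: [set z | e p.2 z && (c p.2 z == c p.1 s)].
have cX : #|X| <= #|W| + 1 + M.
  apply: leq_trans (card_setU_le _ _) _; apply: leq_add; last exact: colour_degree.
  by apply: leq_trans (card_setU_le _ _) _; rewrite cards1.
have sub : [set u | reserved p.2 u] :\: X \subset [set y | P s y].
  apply/subsetP => z; rewrite !inE !negb_or => /andP [/andP [/andP [zW zs] zc] rz].
  rewrite /P sW zW rs rz eq_sym zs /= eq_sym; apply: contra zc => ->; rewrite andbT.
  by case/andP: rz.
have := subset_leq_card sub; have := cardsD [set u | reserved p.2 u] X; have := resW p.2.
have : #|[set u | reserved p.2 u] :&: X| <= #|X| by apply/subset_leq_card/subsetIr.
by move: cX; card_lia.
Qed.

Lemma entry_vertices x bs : exists s, vertices x bs = entry x bs :: s.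
Proof. by case: bs => [|b bs]; [exists [::] | eexists; rewrite /vertices /= -catA; reflexivity]. Qed.

Lemma vertices_cons x b bs : vertices x (b :: bs) = b_vertices b ++ vertices x bs.
Proof. exact: (esym (catA _ _ _)). Qed.

Lemma absorbing_path_exists (N j q a : nat) (v0 : T) :
  0 < D -> 0 < a -> N = 4 * (q * q) * j -> #|T| * #|T| <= 2 ^ j -> #|T| <= q * a ->
  (forall v, a + (1 + N * block_size + 16 * D * M) + 1 + M <= #|[set u | reserved v u]|) ->
  2 * (1 + N * block_size + B + 24 * D * M) <= h ->
  8 * (m + 2 * (B + m) * M) < 3 * h -> 16 * block_size * M <= h ->
  exists bs : seq (block T),
    [/\ size bs = N, absorber v0 bs, uniq (vertices v0 bs),
        size (vertices v0 bs) = 1 + N * block_size &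
        size (all_colours v0 bs) <= h] /\
    forall p, j <= count (absorbs p) bs.
Proof.
move=> D0 a0 NE Tj Tq res_ge hN hnum hM.
(* A new block doubles the weight of the pairs that it fails to absorb and keeps the weight of the
   others. Pairs lagging behind therefore dominate the choice, and a block serving a fraction
   [1 / (q * q)] of the weight multiplies [Phi] by at most [2 - 1 / (q * q)]. *)
pose Phi (bs : seq (block T)) := \sum_(p : T * T) 2 ^ (size bs - count (absorbs p) bs).
have T0 : 0 < #|T| by apply/card_gt0P; exists v0.
have q0 : 0 < q by move: Tq T0; case: (q) => //; lia.
have build i : i <= N -> exists bs : seq (block T),
    [/\ size bs = i, absorber v0 bs, uniq (vertices v0 bs),
        size (vertices v0 bs) = 1 + i * block_size &
        [/\ size (all_colours v0 bs) <= i * (2 * block_size),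
        8 * lost (all_colours v0 bs) (entry v0 bs) <= 2 * h &
        (q * q) ^ i * Phi bs <= (2 * (q * q) - 1) ^ i * (#|T| * #|T|)]].
  elim: i => [|i IHi] iN.
    exists [::]; split=> //; split=> //.
      rewrite /lost /= eq_card0 // => u; rewrite !inE andbF //.
    rewrite /Phi !expn0 !mul1n (eq_bigr (fun=> 1)) // sum_nat_const muln1.
    by rewrite card_prod.
  have [|bs [sbs abs ubs vbs [cbs lbs phi]]] := IHi; first exact: ltnW.
  pose S := all_colours v0 bs; pose W := [set v in vertices v0 bs] :|: spoiled S.
  (* The path has distinct vertices, so it fits into [T]; counting both readings of each block, it
     has used at most [2 * #|T|] colours, as [card_spoiled] demands. *)
  have iT : 1 + i * block_size <= #|T|.
    by rewrite -vbs -(card_uniqP ubs) max_card.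
  have sS : size S <= 2 * #|T| by move: cbs iT; rewrite -/S; clear; move: #|T| => n; nia.
  have cW : #|W| <= 1 + N * block_size + 16 * D * M.
    apply: leq_trans (card_setU_le _ _) _; apply: leq_add; last exact: card_spoiled.
    rewrite cardsE; apply: leq_trans (card_size _) _.
    by rewrite vbs leq_add2l leq_mul2r ltnW ?orbT.
  pose X := [set sz : T * T | [&& sz.1 \notin W, sz.2 \notin W & sz.1 != sz.2]].
  pose ok (p sz : T * T) := [&& reserved p.1 sz.1, reserved p.2 sz.2 & c p.1 sz.1 != c p.2 sz.2].
  have Phi0 : 0 < Phi bs.
    rewrite /Phi (bigD1 (v0, v0)) //= addn_gt0 expn_gt0 //.
  have okX p : a * a <= #|[set sz in X | ok p sz]|.
    apply: good_pairs => v; apply: leq_trans (res_ge v).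
    by rewrite !leq_add2r leq_add2l.
  have cX : #|X| <= q * q * (a * a).
    apply: leq_trans (max_card _) _; rewrite card_prod mulnACA.
    exact: leq_mul.
  have [||[s z] + wsz] := @weighted_pigeonhole _ _ ok
    (fun p => 2 ^ (size bs - count (absorbs p) bs)) X (a * a) (q * q) _ Phi0 okX cX _.
  - by rewrite muln_gt0 a0.
  - by rewrite muln_gt0 q0.
  rewrite inE /= !inE !negb_or => /and3P [/andP [sW sb] /andP [zW zb] sz].
  have [|||b [bs_ bz rot pC [[uV VW sV sC] /= [u1 u2]]]] :=
    @block_exists (vertices v0 bs) S (entry v0 bs) s z D0 sS _ hnum lbs sz sW zW _ _.
  - rewrite vbs; apply: leq_trans hN; rewrite leq_mul2l /= !leq_add2r leq_add2l.
    by rewrite leq_mul2r ltnW ?orbT.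
  - by rewrite inE.
  - by rewrite inE.
  exists (b :: bs).
  have [pV pR VR lV [ucV ucR]] := rot.
  have [pV' cV] := path_fresh_colours pV; have [pR' cR] := path_fresh_colours pR.
  have [pC' cC] := path_fresh_colours pC.
  have sR : size (b_rest b) = D.+1 * (m + 2) by have := perm_size VR; rewrite sV /= => -[].
  have sb_col : size (b_colours b (entry v0 bs)) <= 2 * block_size.
    rewrite /b_colours !size_cat !size_pairmap size_rcons sV sC sR /block_size -/m.
    by clear; nia.
  split.
  - by rewrite /= sbs.
  - split=> //; first by split; rewrite /link_colours bs_ ?bz.
    apply/hasPn => k; rewrite /b_colours /link_colours bs_ bz !mem_cat.
    by case/or3P => [/cV|/cR|/cC].
  - rewrite vertices_cons cat_uniq ubs andbT /b_vertices bs_ uV andTb.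
    apply/hasPn => v vW; rewrite inE negb_or; apply/andP; split.
      by apply: contraNneq sW => <-.
    by apply/negP => /(allP VW); rewrite /= vW.
  - rewrite vertices_cons size_cat vbs /= size_cat sV sC.
    by rewrite /block_size -/m; clear; nia.
  - split.
    + by rewrite /= size_cat mulSn addnC leq_add.
    + rewrite /entry /= bs_; have := lost_cat S (b_colours b (entry v0 bs)) s.
      have : size (b_colours b (entry v0 bs)) * M <= 2 * block_size * M by rewrite leq_mul2r sb_col orbT.
      by move: sb hM; rewrite -leqNgt -/S /=; clear; move: block_size => k; nia.
    + have E : Phi (b :: bs) + \sum_(p | ok p (s, z)) 2 ^ (size bs - count (absorbs p) bs) =
        2 * Phi bs.
        rewrite /Phi big_distrr /= [X in _ + X]big_mkcond -big_split /=; apply: eq_bigr => p _.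
        have cs : count (absorbs p) bs <= size bs by exact: count_size.
        rewrite /absorbs bs_ bz -/(ok p (s, z)); case: ifP => _.
          by rewrite add1n subSS addnn mul2n.
        by rewrite add0n addn0 subSn // expnS.
      have QPhi : q * q * Phi (b :: bs) <= (2 * (q * q) - 1) * Phi bs.
        by move: E wsz; rewrite -/(Phi bs); clear; nia.
      rewrite !expnSr -mulnA; apply: leq_trans (leq_mul (leqnn _) QPhi) _.
      rewrite mulnCA; apply: leq_trans (leq_mul (leqnn _) phi) _.
      by rewrite mulnA [_ * (2 * (q * q) - 1)]mulnC.
have [bs [sbs abs ubs vbs [cbs lbs phi]]] := build N (leqnn N).
exists bs; split; first split=> //.
  by apply: leq_trans cbs _; move: hN; clear; nia.
move=> p; apply: (@potential_bound (q * q) j _ (#|T| * #|T|)) => //.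
- by rewrite muln_gt0 q0.
- rewrite -NE; apply: leq_trans phi; rewrite leq_mul2l; apply/orP; right.
  by rewrite /Phi (bigD1 p) //= sbs leq_addr.
- by rewrite -NE -sbs count_size.
Qed.

End AbsorbingPath.

(** * Rainbow path covers *)

Lemma next_notin (T : eqType) (p : seq T) x : x \notin p -> next p x = x.
Proof. by rewrite next_nth => /negPf ->. Qed.

Lemma map_next (T : eqType) (S : Type) (f : T -> T -> S) y s :
  uniq (y :: s) -> [seq f v (next (y :: s) v) | v <- y :: s] = pairmap f y (rcons s y).
Proof.
move=> us; have z := f y y; apply: (@eq_from_nth _ z).
  by rewrite size_map size_pairmap size_rcons.
move=> i; rewrite size_map => ip.
rewrite (nth_map y) // (nth_pairmap y) ?size_rcons // -rcons_cons.
rewrite [nth y (rcons (y :: s) y) i]nth_rcons ip; congr f.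
rewrite next_nth mem_nth // index_uniq // nth_rcons; case: ltngtP => // si.
  by move: ip; rewrite /= ltnS leqNgt si.
by rewrite nth_default // si.
Qed.

Lemma uniq_map_inj (T S : eqType) (f : T -> S) (s : seq T) :
  uniq (map f s) -> {in s &, injective f}.
Proof.
elim: s => //= a s IHs /andP [fa /IHs inj] x y; rewrite !inE.
case/predU1P => [->|xs]; case/predU1P => [->|ys] // fE.
- by case/negP: fa; rewrite fE map_f.
- by case/negP: fa; rewrite -fE map_f.
- exact: inj.
Qed.

Section NextPerm.
Variables (T : finType) (p : seq T).
Hypothesis Up : uniq p.

Definition next_perm : {perm T} := perm (can_inj (prev_next Up)).

Lemma next_permE x : next_perm x = next p x.
Proof. by rewrite permE. Qed.

Lemma iter_next_neq x i : x \in p -> 0 < i < size p -> iter i (next p) x != x.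
Proof.
move=> xp /andP [i0 ip].
have cyc : fcycle (next p) p by exact: cycle_next.
have := order_cycle cyc Up xp => ordx.
have := orbit_uniq (next p) x; rewrite /fingraph.orbit ordx => Uo.
have := @nth_uniq _ x _ i 0 _ _ Uo; rewrite !size_traject => /(_ ip (ltn_trans i0 ip)).
rewrite !nth_traject ?(ltn_trans i0 ip) //= => ->.
by rewrite -lt0n.
Qed.
End NextPerm.

Section Rewire.
Variables (T : finType) (pi : {perm T}) (A : {set T}) (L : nat) (y : T) (s : seq T).

(** At most [L] steps along the cycle of [pi], in either direction, which makes the relation
    symmetric. *)
Definition near (x : T) : {set T} :=
  [set v | [exists i : 'I_L.+1, ((pi ^+ i)%g x == v) || ((pi ^+ i)%g v == x)]].

Lemma card_near x : #|near x| <= 2 * L.+1.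
Proof.
have sub : near x \subset [set (pi ^+ i)%g x | i : 'I_L.+1] :|: [set (pi ^- i)%g x | i : 'I_L.+1].
  apply/subsetP => v; rewrite !inE => /existsP [i /orP [] /eqP vE]; apply/orP.
    by left; apply/imsetP; exists i.
  by right; apply/imsetP; exists i => //; rewrite -vE permK.
apply: leq_trans (subset_leq_card sub) _; apply: leq_trans (card_setU_le _ _) _.
rewrite mul2n -addnn; apply: leq_add; apply: leq_trans (leq_imset_card _ _) _;
  by rewrite card_ord.
Qed.

Hypothesis no_short : forall x i, x \notin A -> 0 < i <= L -> iter i pi x != x.
Hypothesis spaced : pairwise (fun x a => a \notin near x) (y :: s).
Hypothesis pA : {in y :: s, forall x, x \notin A}.

Lemma spaced_uniq : uniq (y :: s).
Proof.
rewrite uniq_pairwise; apply: sub_pairwise spaced => x a; apply: contra => /eqP ->.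
by rewrite inE; apply/existsP; exists ord0; rewrite expg0 perm1 eqxx.
Qed.

Lemma iter_pi_notin w k : w \in y :: s -> 0 < k <= L -> iter k pi w \notin y :: s.
Proof.
move=> wp kL; apply/negP => up; set u := iter k pi w in up.
have wu : u != w by apply: no_short => //; exact: pA.
pose rr x a := a \notin near x.
have rr_sym x a : rr x a = rr a x.
  by rewrite /rr !inE; congr negb; apply: eq_existsb => i; rewrite orbC.
have : rr w u.
  have /pairwiseP := spaced => /(_ w) P.
  have iw : index w (y :: s) < size (y :: s) by rewrite index_mem.
  have iu : index u (y :: s) < size (y :: s) by rewrite index_mem.
  case: (ltngtP (index w (y :: s)) (index u (y :: s))) => h.
  - by have := P _ _ iw iu h; rewrite !nth_index.
  - by have := P _ _ iu iw h; rewrite !nth_index // -/(rr u w) rr_sym.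
  - by move: wu; rewrite -(nth_index w up) -h nth_index // eqxx.
rewrite /rr inE => /existsP []; have kL' : k < L.+1 by lia.
by exists (Ordinal kL'); rewrite /= permX eqxx.
Qed.

(** Each vertex of the chain takes over the arc of its successor: for [s = [:: a1; ...; am]], [y]
    goes to [pi a1], [a1] to [pi a2], and finally [am] to [pi y]. *)
Definition rewired : {perm T} := (next_perm spaced_uniq * pi)%g.

Lemma rewiredE x : rewired x = pi (next (y :: s) x).
Proof. by rewrite permM next_permE. Qed.

(** From a chain vertex, [rewired] enters the arc of the next chain vertex and then follows [pi] for
    [L] steps without meeting the chain again, because chain vertices are pairwise far apart. An
    orbit that avoids the chain is unchanged. *)
Lemma rewired_no_short x i : x \notin A -> 0 < i <= L -> iter i rewired x != x.
Proof.
move=> xA iL.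
have claim v k : v \in y :: s -> 0 < k <= L ->
    iter k rewired v = iter k pi (next (y :: s) v).
  move=> vp; elim: k => // k IHk kL; rewrite !iterS.
  case: (posnP k) => [->|k0]; first by rewrite /= rewiredE.
  have kL' : 0 < k <= L by lia.
  by rewrite IHk // rewiredE next_notin // iter_pi_notin // mem_next.
have notp v : v \in y :: s -> iter i rewired v != v.
  move=> vp; rewrite claim //; apply/eqP => E.
  by have := @iter_pi_notin (next (y :: s) v) i; rewrite mem_next E vp => /(_ isT iL).
have [/existsP [k kp]|none] := boolP [exists k : 'I_i, iter k rewired x \in y :: s].
  apply/eqP => E; have := notp _ kp; rewrite -iterD addnC iterD E eqxx //.
have same k : k <= i -> iter k rewired x = iter k pi x.
  elim: k => // k IHk ki; rewrite !iterS -IHk ?(ltnW ki) // rewiredE next_notin //.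
  by apply: contra none => kp; apply/existsP; exists (Ordinal ki).
by rewrite same // no_short.
Qed.

End Rewire.

Section Cover.
Variables (T K : finType) (e : rel T) (c : T -> T -> K) (U : {set K}).
Variables (D h t d M : nat).
Hypotheses (e_sym : symmetric e) (c_sym : forall x y, c x y = c y x).
Hypotheses (h_gt0 : 0 < h) (n_le : #|T| <= D * h) (h_le_t : h <= t) (t_le_d : 4 * t <= d).
Hypothesis deg : forall v, d <= #|neighbours e v|.
Hypothesis robust : robustly_expanding e h t.
Hypothesis col_le : forall k, #|[set p : T * T | e p.1 p.2 && (c p.1 p.2 == k)]| <= M.
Hypothesis U_small : forall v, 4 * #|[set u | e v u && (c v u \in U)]| <= h.
Variables (A : {set T}) (SA : seq K) (L : nat).
Hypotheses (D_gt0 : 0 < D) (SA_le : size SA <= #|T|) (A_le : 2 * (#|A| + 24 * D * M) <= h).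
Hypothesis hnum : 8 * (2 * L.+1 * D.+1.*2 + 2 * D.+1.*2 * M) < 3 * h.

(* [E] is the set of vertices whose arc [v -> pi v] is an actual edge; the other arcs are
   placeholders, so that the partial cover is carried by a permutation. *)
Definition linking (pi : {perm T}) (E : {set T}) : Prop :=
  [/\ forall x, x \in A -> pi x = x, [disjoint E & A],
      forall v, v \in E -> fresh e c U SA v (pi v),
      {in E &, injective (fun v => c v (pi v))} &
      forall x i, x \notin A -> 0 < i <= L -> iter i pi x != x].

(** A single cycle through all vertices off [A], all of whose arcs are placeholders. *)
Lemma linking_init : L < #|~: A| -> exists pi, linking pi set0.
Proof.
move=> LA; have Up : uniq (enum (~: A)) by exact: enum_uniq.
exists (next_perm Up); split.
- by move=> x xA; rewrite next_permE next_notin // mem_enum inE xA.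
- by rewrite disjoint_subset; apply/subsetP => x; rewrite inE.
- by move=> v; rewrite inE.
- by move=> v w; rewrite inE.
move=> x i xA /andP [i0 iL].
rewrite (eq_iter (next_permE Up)) iter_next_neq ?mem_enum ?inE // i0 -cardE.
exact: leq_ltn_trans LA.
Qed.

(** At most [16 * D * M] vertices are spoiled and [pi] is injective, so some missing arc runs from
    an unspoiled [y] to an unspoiled [pi y]. Rewiring along a chain between them gives every chain
    vertex a genuine edge: the hole at [y] closes and none opens. The new colours avoid those of all
    present arcs, including the arcs about to be dropped. *)
Lemma linking_step pi E : linking pi E -> 32 * D * M < #|~: (A :|: E)| ->
  exists pi' E', linking pi' E' /\ #|~: (A :|: E')| < #|~: (A :|: E)|.
Proof.
move=> [piA EA Efresh Einj no_short] holes.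
pose S := SA ++ [seq c v (pi v) | v <- enum E].
have sS : size S <= 2 * #|T|.
  rewrite size_cat size_map -cardE mul2n -addnn leq_add //; exact: max_card.
have csp := card_spoiled U h_gt0 n_le col_le sS.
set sp := spoiled e c U h S in csp.
have [y yH /norP [ysp pysp]] : exists2 y, y \in ~: (A :|: E) & ~~ ((y \in sp) || (pi y \in sp)).
  have : ~~ (~: (A :|: E) \subset sp :|: pi @^-1: sp).
    apply/negP => /subset_leq_card; have := card_setU_le sp (pi @^-1: sp).
    have : #|pi @^-1: sp| <= #|sp|.
      rewrite -(card_imset _ (@perm_inj _ pi)); apply/subset_leq_card/subsetP.
      by move=> _ /imsetP [x + ->]; rewrite inE.
    by move: holes csp; card_lia.
  case/subsetPn => y yH h'; exists y => //; apply: contra h' => /orP [h1|h1].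
    by apply/setUP; left.
  by apply/setUP; right; rewrite in_set.
have yA : y \notin A by move: yH; rewrite !inE => /norP [].
have yE : y \notin E by move: yH; rewrite !inE => /norP [].
pose Z := A :|: sp.
have cZ : 2 * (#|Z| + 8 * D * M) <= h.
  by have := card_setU_le A sp; move: csp A_le; rewrite -/Z; card_nia.
have sploss v : v \notin sp -> #|neighbours e v :\: neighbours (fresh e c U S) v| <= h./2.
  by rewrite inE -leqNgt => lv; apply: fresh_loss => //; move: lv; clear; lia.
have lossZ v : v \notin Z -> #|neighbours e v :\: neighbours (fresh e c U S) v| <= h./2.
  by rewrite inE => /norP [_]; exact: sploss.
have l2 : 2 * h./2 <= h by rewrite mul2n -[X in _ <= X]odd_double_half leq_addl.
have Dm : 2 * D < D.+1.*2 by clear; lia.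
have [|s [sz sZ ssp spath [slast sun _]]] := @chain_exists T K e (fresh e c U S) c pi D h t d M h./2
  (2 * L.+1) D.+1.*2 Z (near pi L) (fresh_sym U e_sym c_sym S) c_sym h_gt0 n_le h_le_t t_le_d deg
  robust lossZ l2 (fresh_colour_degree U col_le S) cZ (@card_near T pi L) (pi y) (sploss _ pysp) y [::]
  (sploss _ ysp) D_gt0 Dm.
  by rewrite add0n.
have pA : {in y :: s, forall x, x \notin A}.
  move=> x; rewrite inE => /orP [/eqP -> //|/(allP sZ)].
  by rewrite /= inE => /norP [].
have us := spaced_uniq ssp; pose pi' := rewired ssp.
have pi'E x : pi' x = pi (next (y :: s) x) by exact: rewiredE.
have pi'out x : x \notin y :: s -> pi' x = pi x by move=> xp; rewrite pi'E next_notin.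
have newfresh v : v \in y :: s -> fresh e c U S v (pi' v).
  move=> vp; rewrite pi'E.
  have cyc : path.cycle (fun u a => fresh e c U S u (pi a)) (y :: s).
    by rewrite /= rcons_path spath slast.
  exact: (next_cycle cyc vp).
have newcol : uniq [seq c v (pi' v) | v <- y :: s].
  have -> : [seq c v (pi' v) | v <- y :: s] =
      pairmap (fun u a => c u (pi a)) y (rcons s y).
    rewrite -map_next //; apply/eq_map => v; by rewrite pi'E.
  by rewrite pairmap_rcons.
have colE v : v \in E -> c v (pi v) \in S.
  by move=> vE; rewrite mem_cat; apply/orP; right; apply: map_f; rewrite mem_enum.
exists pi', (E :|: [set x in y :: s]); split; last first.
  apply: proper_card; apply/properP; split.
    by apply/subsetP => x; rewrite !inE !negb_or => /andP [-> /andP [->]].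
  by exists y => //; rewrite !inE eqxx !orbT.
split.
- move=> x xA; rewrite pi'out ?piA //; apply/negP => /pA; by rewrite xA.
- rewrite -setI_eq0; apply/eqP/setP => x; rewrite !inE; apply/negP => /andP [xEp xA].
  case/orP: xEp => [xE|xp]; last by have := pA x; rewrite inE xp xA => /(_ isT).
  by have := disjointFr EA xE; rewrite xA.
- move=> v; have [vp _|vp] := boolP (v \in y :: s).
    have := newfresh v vp; rewrite /fresh => /andP [-> ]; rewrite mem_cat negb_or.
    by case/andP.
  rewrite !inE; move: (vp); rewrite inE => /negPf ->; rewrite orbF => vE.
  by rewrite pi'out // Efresh.
- have mem_new v : v \in E :|: [set x in y :: s] -> v \notin y :: s -> v \in E.
    by rewrite in_setU in_set => /orP [//|->].
  have cross v u : v \in y :: s -> u \in E -> u \notin y :: s -> c v (pi' v) <> c u (pi' u).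
    move=> vp uE up E1; have := newfresh v vp; rewrite /fresh => /andP [_].
    by rewrite E1 (pi'out u up) colE.
  move=> v u vn un /= E1.
  have [vp|vp] := boolP (v \in y :: s); have [up|up] := boolP (u \in y :: s).
  + exact: (uniq_map_inj newcol vp up E1).
  + by case: (cross v u vp (mem_new u un up) up).
  + by case: (cross u v up (mem_new v vn vp) vp).
  + by apply: Einj; rewrite ?mem_new // -(pi'out v vp) -(pi'out u up).
- exact: rewired_no_short.
Qed.

Lemma linking_exists : L < #|~: A| ->
  exists pi E, linking pi E /\ #|~: (A :|: E)| <= 32 * D * M.
Proof.
move=> /linking_init [pi0 lk0].
have [k] := ubnP #|~: (A :|: set0)|; move: (set0) pi0 lk0; elim: k => // k IHk E pi lk cE.
have [le|/(linking_step lk) [pi' [E' [lk' ltE]]]] := leqP #|~: (A :|: E)| (32 * D * M).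
  by exists pi, E.
exact: IHk lk' (leq_trans ltE cE).
Qed.

Lemma split_at_holes (pi : {perm T}) (E : {set T}) x s : fpath pi x s ->
  exists ps : seq (seq T),
    [/\ flatten ps = x :: s, all (fun p => p != [::]) ps,
        size ps <= (count [predC E] (x :: s)).+1 &
        all (fun p => if p is a :: q then path (fun u v => (u \in E) && (v == pi u)) a q else true) ps].
Proof.
elim: s x => [|y s IHs] x /=; first by exists [:: [:: x]].
case/andP => /eqP xy /IHs [ps [fps nps sps aps]].
have [xE|xE] := boolP (x \in E); last first.
  by exists ([:: x] :: ps); split; rewrite /= ?fps.
case: ps fps nps sps aps => [//|[//|a q] ps] /= [ay fps] nps sps /andP [aq aps].
subst a; exists ((x :: y :: q) :: ps); split=> //=; first by rewrite fps.
by rewrite xE xy eqxx aq.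
Qed.

(** A cycle cut at its missing arcs yields at most one piece more than it has such arcs, and there
    are at most [#|B| / L] cycles since each is longer than [L]. The induction removes one orbit at
    a time from the stable set [B]. *)
Lemma path_decomposition (pi : {perm T}) (E B : {set T}) :
  (forall x, x \in B -> pi x \in B) ->
  (forall x i, x \in B -> 0 < i <= L -> iter i pi x != x) ->
  exists ps : seq (seq T),
    [/\ uniq (flatten ps), flatten ps =i B, all (fun p => p != [::]) ps,
        L * size ps <= L * #|B :\: E| + #|B| &
        all (fun p => if p is a :: q then path (fun u v => (u \in E) && (v == pi u)) a q else true) ps].
Proof.
have [k] := ubnP #|B|; elim: k B => // k IHk B cB stable no_short.
have [->|/set0Pn [x xB]] := eqVneq B set0.
  by exists [::]; split=> // [x|]; rewrite ?inE ?muln0.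
have pi_inj : injective pi by exact: perm_inj.
pose O := [set v in fingraph.orbit pi x].
have xO : x \in O by rewrite inE -fconnect_orbit.
have OB : O \subset B.
  apply/subsetP => v; rewrite inE -fconnect_orbit => /connectP [q qp ->].
  by elim: q x xB qp {O xO} => //= a q IHq x xB /andP [/eqP <-] qp; apply: IHq => //; exact: stable.
have stabC v : v \in B :\: O -> pi v \in B :\: O.
  rewrite !inE -!fconnect_orbit => /andP [vO vB]; rewrite stable // andbT.
  by rewrite -(same_fconnect1_r pi_inj).
have cBO : #|B :\: O| + #|O| = #|B| by rewrite addnC -(cardsID O B) (setIidPr OB).
have O0 : 0 < #|O| by apply/card_gt0P; exists x.
have [||| ps [ups eps nps sps aps]] := IHk (B :\: O).
- by move: cB cBO O0; card_lia.
- exact: stabC.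
- by move=> v i; rewrite inE => /andP [_ vB]; exact: no_short.
have sizeO : size (fingraph.orbit pi x) = #|O|.
  by rewrite cardsE (card_uniqP (orbit_uniq _ _)).
have LO : L < #|O|.
  rewrite -sizeO size_orbit ltnNge; apply/negP => ordL.
  have := no_short x (fingraph.order pi x) xB; rewrite iter_order // eqxx fingraph.order_gt0 ordL.
  by move/(_ isT).
have [q oE] : exists q, fingraph.orbit pi x = x :: q.
  by rewrite /fingraph.orbit -orderSpred /=; eexists.
have [ps1 [f1 n1 s1 a1]] : exists ps1 : seq (seq T),
    [/\ flatten ps1 = x :: q, all (fun p => p != [::]) ps1,
        size ps1 <= (count [predC E] (x :: q)).+1 &
        all (fun p => if p is a :: q then path (fun u v => (u \in E) && (v == pi u)) a q else true) ps1].
  apply: split_at_holes; have := fpath_traject pi x (fingraph.order pi x).-1.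
  by move: oE; rewrite /fingraph.orbit -orderSpred /= => -[<-].
exists (ps1 ++ ps); split.
- rewrite flatten_cat cat_uniq ups f1 -oE orbit_uniq andbT andTb.
  apply/hasPn => v; rewrite eps !inE => /andP [] //.
- move=> v; rewrite flatten_cat mem_cat eps f1 -oE !inE.
  have [vo|//] := boolP (v \in fingraph.orbit pi x).
  by rewrite (subsetP OB) // inE.
- by rewrite all_cat n1.
- have cE : count [predC E] (x :: q) = #|O :\: E|.
    rewrite -oE -size_filter -(card_uniqP _) ?filter_uniq ?orbit_uniq //.
    by apply: eq_card => v; rewrite mem_filter !inE.
  have : #|O :\: E| + #|(B :\: O) :\: E| <= #|B :\: E|.
    rewrite -(cardsID O (B :\: E)); apply: leq_add; apply/subset_leq_card/subsetP => v.
      by rewrite !inE => /andP [-> vo]; rewrite vo (subsetP OB) // inE.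
    by rewrite !inE => /and3P [-> -> ->].
  rewrite cE in s1; rewrite size_cat; move: s1 sps LO cBO; move: (size ps1) (size ps) => a b.
  by card_nia.
- by rewrite all_cat a1.
Qed.

Definition path_colours (p : seq T) : seq K := if p is x :: s then pairmap c x s else [::].

Lemma rainbow_path_cover : L < #|~: A| ->
  exists ps : seq (seq T),
    [/\ uniq (flatten ps), flatten ps =i ~: A, all (fun p => p != [::]) ps,
        L * size ps <= L * (32 * D * M) + #|T| &
        all (fun p => if p is x :: s then path (fresh e c U SA) x s else true) ps /\
        uniq (flatten (map path_colours ps))].
Proof.
move=> LA; have [pi [E [[piA EA Efresh Einj no_short] holes]]] := linking_exists LA.
have [||ps [ups eps nps sps aps]] := @path_decomposition pi E (~: A).
- move=> x; rewrite !inE; apply: contra => pxA.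
  by have /perm_inj <- := piA _ pxA.
- by move=> x i; rewrite inE; exact: no_short.
exists ps; split=> //.
- have : #|~: A :\: E| <= 32 * D * M.
    by apply: leq_trans holes; apply/subset_leq_card/subsetP => v; rewrite !inE negb_or andbC.
  have : #|~: A| <= #|T| by exact: max_card.
  by move: sps; move: (size ps) => a; card_nia.
split.
  apply: sub_all aps => -[//|x s]; apply: sub_path => u v /andP [uE /eqP ->].
  exact: Efresh.
pose f v := c v (pi v).
(* [bs] lists the tails of the arcs in use. They are distinct members of [E], on which the colour of
   the outgoing arc is injective. *)
have [bs [bE bs_sub]] : exists bs : seq T,
   [/\ flatten (map path_colours ps) = map f bs, subseq bs (flatten ps) & {subset bs <= E}].
  elim: (ps) aps => [|[|x s] ps' IH] /=; first by exists [::].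
    exact: IH.
  case/andP => xs /IH [bs [-> sub subE]]; exists (belast x s ++ bs).
  rewrite map_cat; split.
  - congr (_ ++ _); elim: s x xs {sub} => //= y s IHs x /andP [/andP [_ /eqP yE] ys].
    by rewrite IHs // /f yE.
  - have : subseq (belast x s ++ bs) ((x :: s) ++ flatten ps').
      by apply: cat_subseq => //; rewrite lastI -cats1 prefix_subseq.
    by [].
  - move=> v; rewrite mem_cat => /orP [|/subE //].
    elim: s x xs {sub} => //= y s IHs x /andP [/andP [xE _] ys]; rewrite inE.
    by case/predU1P => [-> //|]; exact: IHs.
move=> subE; rewrite bE map_inj_in_uniq; first exact: subseq_uniq ups.
by move=> u v /subE uE /subE vE; exact: Einj.
Qed.

End Cover.

(** * Absorption *)

Lemma uniq_flatten_map (A B : eqType) (F : A -> seq B) (s : seq A) :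
  uniq s -> {in s, forall x, uniq (F x)} ->
  {in s &, forall x y, x != y -> ~~ has (mem (F x)) (F y)} ->
  uniq (flatten (map F s)).
Proof.
elim: s => //= a s IHs /andP [as_ us] uF dF.
rewrite cat_uniq uF ?inE ?eqxx //= IHs //; last first.
- by move=> x y xs ys; apply: dF; rewrite inE ?xs ?ys orbT.
- by move=> x xs; apply: uF; rewrite inE xs orbT.
rewrite andbT; apply/hasPn => b /flattenP [_ /mapP [x xs ->] bx].
have ax : a != x by apply: contraNneq as_ => ->.
have := dF a x; rewrite !inE eqxx xs orbT => /(_ isT isT ax) /hasPn; exact.
Qed.

Section ChooseBlocks.
Variables (T K : finType) (e : rel T) (c : T -> T -> K) (U : {set K}) (M w : nat).
Hypothesis col_le : forall k, #|[set p : T * T | e p.1 p.2 && (c p.1 p.2 == k)]| <= M.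
Variables (bs : seq (block T)) (I : finType) (y x : I -> T).
Hypotheses (u_start : uniq (map (@b_start T) bs)) (u_exit : uniq (map (@b_exit T) bs)).
Hypotheses (y_inj : injective y) (x_inj : injective x).
Hypotheses (w_gt0 : 0 < w) (w_ge : 4 * (#|I| + 4 * M) <= w).
Hypothesis absorb_ge : forall i, w <= count (absorbs e c U (y i, x i)) bs.

(** An independent transversal whose options are the positions in [bs]. As ends, starts and exits
    are all distinct, different choices use different edges on each side, so a colour occurs in at
    most [2 * M] choices. A choice then conflicts with at most [4 * M] others through its two
    colours and [#|I|] through its block. *)
Lemma choose_blocks : exists g : I -> block T,
  [/\ injective g, forall i, g i \in bs, forall i, absorbs e c U (y i, x i) (g i) &
   forall i j, i != j ->
     ~~ has (mem [:: c (y i) (b_start (g i)); c (x i) (b_exit (g i))])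
        [:: c (y j) (b_start (g j)); c (x j) (b_exit (g j))]].
Proof.
case: (pickP (fun _ : I => true)) => [i0 _|none]; last first.
  have g (i : I) : block T by have := none i.
  by exists g; split=> i; have := none i.
have N0 : 0 < size bs.
  by apply: leq_trans w_gt0 _; apply: leq_trans (absorb_ge i0) (count_size _ _).
have [b0 _] : exists b0 : block T, true by case: (bs) N0 => // b0; exists b0.
pose B (k : 'I_(size bs)) := nth b0 bs k.
pose L i := [set k | absorbs e c U (y i, x i) (B k)].
have cL i : w <= #|L i|.
  apply: leq_trans (absorb_ge i) _.
  by rewrite -sum1_count (big_nth b0) big_mkord sum1dep_card.
pose cols i k := [:: c (y i) (b_start (B k)); c (x i) (b_exit (B k))].
pose conf i k j l := (k == l) || has (mem (cols i k)) (cols j l).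
have conf_sym i k j l : conf i k j l = conf j l i k.
  by rewrite /conf eq_sym; congr orb; rewrite [LHS]has_sym.
have B_inj : injective B.
  move=> k l /(congr1 (@b_start T)); rewrite /B -!(nth_map b0 (b_start b0) (@b_start T)) //.
  by move/eqP; rewrite nth_uniq ?size_map // => /eqP; exact: val_inj.
have start_inj : injective (fun k => b_start (B k)).
  move=> k l /=; rewrite /B -!(nth_map b0 (b_start b0) (@b_start T)) //.
  by move/eqP; rewrite nth_uniq ?size_map // => /eqP; exact: val_inj.
have exit_inj : injective (fun k => b_exit (B k)).
  move=> k l /=; rewrite /B -!(nth_map b0 (b_exit b0) (@b_exit T)) //.
  by move/eqP; rewrite nth_uniq ?size_map // => /eqP; exact: val_inj.
have deg_col k' :
    #|[set p : I * 'I_(size bs) | (p.2 \in L p.1) && (k' \in cols p.1 p.2)]| <= 2 * M.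
  pose f (p : I * 'I_(size bs)) := (y p.1, b_start (B p.2)).
  pose g (p : I * 'I_(size bs)) := (x p.1, b_exit (B p.2)).
  have f_inj : injective f by move=> [i k] [j l] [/y_inj -> /start_inj ->].
  have g_inj : injective g by move=> [i k] [j l] [/x_inj -> /exit_inj ->].
  pose S := [set p : T * T | e p.1 p.2 && (c p.1 p.2 == k')].
  apply: (@leq_trans (#|f @^-1: S| + #|g @^-1: S|)).
    apply: leq_trans (card_setU_le _ _); apply/subset_leq_card/subsetP => [[i k]].
    rewrite !inE /= => /andP [/and3P [/andP [-> _] /andP [-> _] _]] /orP [] /eqP ->;
      by rewrite eqxx ?orbT.
  have cS : #|S| <= M by exact: col_le.
  rewrite mul2n -addnn; apply: leq_add; apply: leq_trans cS.
    rewrite -(card_imset _ f_inj); apply/subset_leq_card/subsetP => _ /imsetP [p + ->].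
    by rewrite inE.
  rewrite -(card_imset _ g_inj); apply/subset_leq_card/subsetP => _ /imsetP [p + ->].
  by rewrite inE.
have [|f [fL fconf]] := @independent_transversal I _ (Ordinal N0) conf conf_sym L w
    (#|I| + 4 * M) w_gt0 cL w_ge.
- move=> i k kL.
  pose X1 := [set (j, k) | j : I].
  pose X2 k' := [set p : I * 'I_(size bs) | (p.2 \in L p.1) && (k' \in cols p.1 p.2)].
  apply: (@leq_trans #|X1 :|: X2 (c (y i) (b_start (B k))) :|: X2 (c (x i) (b_exit (B k)))|).
    apply/subset_leq_card/subsetP => [[j l]]; rewrite inE /= => /and3P [_ lL].
    case/orP => [/eqP <-|/hasP [k' kj ki]].
      by rewrite !inE; apply/orP; left; apply/orP; left; apply/imsetP; exists j.
    rewrite in_setU; move: ki; rewrite /= inE => /orP [/eqP <-|].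
      by rewrite in_setU [_ \in X2 _]inE lL kj orbT.
    by rewrite inE => /eqP <-; rewrite [_ \in X2 _]inE lL kj orbT.
  have c1 : #|X1| <= #|I| by exact: leq_imset_card.
  have := deg_col (c (y i) (b_start (B k))); have := deg_col (c (x i) (b_exit (B k))).
  have := card_setU_le (X1 :|: X2 (c (y i) (b_start (B k)))) (X2 (c (x i) (b_exit (B k)))).
  have := card_setU_le X1 (X2 (c (y i) (b_start (B k)))).
  by move: c1; rewrite -/(X2 (c (y i) (b_start (B k)))) -/(X2 (c (x i) (b_exit (B k)))); card_lia.
exists (fun i => B (f i)); split=> [i j /B_inj fij|i|i|i j ij].
- apply/eqP; apply: contraT => ij; have := fconf i j ij.
  by rewrite /conf fij eqxx.
- by rewrite mem_nth.
- by have := fL i; rewrite inE.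
- by have := fconf i j ij; rewrite /conf negb_or => /andP [].
Qed.
End ChooseBlocks.

Section Route.
Variables (T K : finType) (e : rel T) (c : T -> T -> K) (U : {set K}).
Hypotheses (e_sym : symmetric e) (c_sym : forall x y, c x y = c y x).
Variable ins : block T -> seq T.

Local Notation absorber := (absorber e c U).
Local Notation all_colours := (all_colours c).

Definition insertable (b : block T) : bool :=
  if ins b is y :: P
  then [&& e (b_start b) y, path e y P & e (last y P) (b_exit b)] else true.

Definition detour (b : block T) : seq T :=
  (if ins b is y :: P then ins b ++ b_exit b :: b_rest b else b_path b) ++ b_link b.

Fixpoint route (x : T) (bs : seq (block T)) (tl : seq T) : seq T :=
  if bs is b :: bs' then detour b ++ entry x bs' :: route x bs' tl else tl.

Definition new_colours (b : block T) : seq K :=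
  if ins b is y :: P then [:: c (b_start b) y; c (last y P) (b_exit b)] else [::].

(** The flag [rot] is kept apart from [ins] because the block closing the cycle is read through its
    rest although no path is inserted there. *)
Definition base_colours (rot : block T -> bool) (b : block T) (x : T) : seq K :=
  (if rot b then pairmap c (b_exit b) (b_rest b) else pairmap c (b_start b) (b_path b))
  ++ link_colours c b x.

Fixpoint all_base (rot : block T -> bool) (x : T) (bs : seq (block T)) : seq K :=
  if bs is b :: bs' then base_colours rot b (entry x bs') ++ all_base rot x bs' else [::].

Lemma unreserved_path x s : path (unreserved e c U) x s -> path e x s.
Proof. by apply: sub_path => u v /andP []. Qed.

Lemma detour_path b x : block_ok e c U b x -> insertable b ->
  path e (b_start b) (rcons (detour b) x).
Proof.
case=> [[pV pR VR lV _]] pC _ _; rewrite /insertable /detour.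
move/unreserved_path: pV => pV; move/unreserved_path: pR => pR; move/unreserved_path: pC => pC.
case: (ins b) => [_|y P /and3P [sy yP Pz]].
  by rewrite rcons_cat cat_path pV pC.
by rewrite rcons_cat cat_path /= sy cat_path yP /= Pz pR !last_cat /= ?last_cat /= -lV.
Qed.

Lemma route_path x bs tl : absorber x bs -> all insertable bs -> path e x tl ->
  path e (entry x bs) (route x bs tl).
Proof.
elim: bs => //= b bs IHbs [ok _ abs] /andP [ib ibs] ptl.
have pb := detour_path ok ib.
by rewrite -cat_rcons cat_path last_rcons pb IHbs.
Qed.

Lemma route_last x bs tl : last (entry x bs) (route x bs tl) = last x tl.
Proof. by elim: bs => //= b bs IHbs; rewrite last_cat. Qed.

Lemma route_colours x bs tl : absorber x bs ->
  perm_eq (pairmap c (entry x bs) (route x bs tl))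
    (all_base (fun b => ins b != [::]) x bs ++ flatten (map new_colours bs) ++
     flatten (map (fun b => path_colours c (ins b)) bs) ++ pairmap c x tl).
Proof.
elim: bs => [|b bs IHbs] /=; first by rewrite perm_refl.
case=> [[[_ _ _ lV _] _ _ _] _ abs]; have {IHbs} := IHbs abs.
change (entry x (b :: bs)) with (b_start b).
set x' := entry x bs; set Q := pairmap c x' _; set B := all_base _ _ _.
rewrite -cat_rcons pairmap_cat last_rcons -/Q => /seq.permP IH; apply/seq.permP => P.
have := IH P; rewrite /base_colours /new_colours /path_colours /detour /link_colours.
case: (ins b) => [|y s] /=.
  by rewrite rcons_cat pairmap_cat !count_cat; clear; lia.
rewrite rcons_cat /= pairmap_cat /= last_cat /= lV.
by rewrite !(pairmap_cat, count_cat) /= !count_cat /=; clear; lia.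
Qed.

Lemma route_perm x bs tl : absorber x bs ->
  perm_eq (entry x bs :: route x bs tl)
    (flatten (map (@b_vertices T) bs) ++ flatten (map ins bs) ++ x :: tl).
Proof.
elim: bs => [|b bs IHbs] /=; first by rewrite perm_refl.
change (entry x (b :: bs)) with (b_start b).
case=> [[[_ _ VR _ _] _ _ _] _ abs]; have {IHbs} := IHbs abs.
move/seq.permP => IH; apply/seq.permP => P; have := IH P; have := seq.permP VR P.
rewrite /detour; case: (ins b) => [|y s] /=; rewrite !count_cat /=; first by clear; lia.
by rewrite ?count_cat /= ?count_cat /=; clear; lia.
Qed.

Lemma all_base_cat rot x bs1 bs2 :
  all_base rot x (bs1 ++ bs2) = all_base rot (entry x bs2) bs1 ++ all_base rot x bs2.
Proof.
elim: bs1 => //= b bs1 ->; rewrite -catA; congr (base_colours _ _ _ ++ _).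
by case: bs1.
Qed.

Lemma entry_cat (x : T) (bs1 bs2 : seq (block T)) : entry x (bs1 ++ bs2) = entry (entry x bs2) bs1.
Proof. by case: bs1. Qed.

Lemma absorber_cat x bs1 bs2 : absorber x (bs1 ++ bs2) ->
  absorber (entry x bs2) bs1 /\ absorber x bs2.
Proof.
elim: bs1 => //= b bs1 IHbs [ok fr /IHbs [abs1 abs2]]; split=> //.
rewrite -entry_cat; split=> //.
apply: contra fr => /hasP [k kb k1]; apply/hasP; exists k => //.
move: k1 => /=; elim: (bs1) => //= b1 bs1' IH; rewrite !mem_cat -entry_cat.
by case/orP => [/IH ->|->] //; rewrite orbT.
Qed.

Lemma base_sub rot b x : {subset base_colours rot b x <= b_colours c b x}.
Proof.
move=> k; rewrite /base_colours /b_colours !mem_cat.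
by case: ifP => _ /orP [] ->; rewrite ?orbT.
Qed.

Lemma all_base_sub rot x bs : {subset all_base rot x bs <= all_colours x bs}.
Proof.
elim: bs => //= b bs IHbs k; rewrite mem_cat => /orP [/base_sub kb|/IHbs kb];
  by rewrite mem_cat kb ?orbT.
Qed.

Lemma uniq_all_base rot x bs : absorber x bs -> uniq (all_base rot x bs).
Proof.
elim: bs => //= b bs IHbs [[_ _ u1 u2] fr /IHbs ubs].
rewrite cat_uniq ubs andbT; apply/andP; split; first by rewrite /base_colours; case: ifP.
apply/hasPn => k kb; apply: contra fr => kb'; apply/hasP; exists k; first exact: base_sub kb'.
exact: all_base_sub kb.
Qed.

Lemma all_colours_unreserved x bs : absorber x bs ->
  forall k, k \in all_colours x bs -> k \notin U.
Proof.
have pU a s : path (unreserved e c U) a s -> forall k, k \in pairmap c a s -> k \notin U.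
  elim: s a => //= a' s IHs a /andP [/andP [_ aU] /IHs IH] k.
  by rewrite inE => /orP [/eqP ->|/IH].
elim: bs => //= b bs IHbs [[[pV pR _ _ _] pC _ _] _ /IHbs IH] k.
rewrite !mem_cat => /or4P [/IH //|||]; exact: pU.
Qed.

End Route.

Lemma uniq_flatten_nth (A : eqType) (ps : seq (seq A)) i j v :
  uniq (flatten ps) -> i < size ps -> j < size ps ->
  v \in nth [::] ps i -> v \in nth [::] ps j -> i = j.
Proof.
have sub k qs : k < size qs -> v \in nth [::] qs k -> v \in flatten qs.
  by move=> kq vk; apply/flattenP; exists (nth [::] qs k); rewrite // mem_nth.
elim: ps i j => //= p ps IHps i j; rewrite cat_uniq => /and3P [_ /hasPn dis ups].
case: i => [|i]; case: j => [|j] //= ip jp vi vj.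
- by have := dis v (sub _ _ jp vj); rewrite /= vi.
- by have := dis v (sub _ _ ip vi); rewrite /= vj.
- by rewrite (IHps i j).
Qed.

Section Assembly.
Variables (T K : finType) (e : rel T) (c : T -> T -> K) (U : {set K}) (M w : nat).
Hypotheses (e_sym : symmetric e) (c_sym : forall x y, c x y = c y x).
Hypothesis col_le : forall k, #|[set p : T * T | e p.1 p.2 && (c p.1 p.2 == k)]| <= M.
Variables (v0 : T) (bs : seq (block T)) (ps : seq (seq T)).
Hypotheses (abs : absorber e c U v0 bs) (uv : uniq (vertices v0 bs)).
Hypotheses (ups : uniq (flatten ps)) (ps_cover : flatten ps =i [predC vertices v0 bs]).
Hypothesis ps_nonempty : all (fun p => p != [::]) ps.
Hypothesis ps_path : all (fun p =>
  if p is x :: s then path (fresh e c U (all_colours c v0 bs)) x s else true) ps.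
Hypothesis ps_rainbow : uniq (flatten (map (path_colours c) ps)).
Hypotheses (w_gt0 : 0 < w) (w_ge : 4 * ((size ps).+1 + 4 * M) <= w).
Hypothesis absorb_ge : forall p, w <= count (absorbs e c U p) bs.

Let q := size ps.
(** The index [None] stands for closing the cycle: the two ends of the absorbing path itself form
    one more pair to be absorbed. *)
Let y (i : option 'I_q) : T := if i is Some i' then head v0 (nth [::] ps i') else v0.
Let x (i : option 'I_q) : T := if i is Some i' then last v0 (nth [::] ps i') else entry v0 bs.

Lemma nth_piece (i : 'I_q) : exists a s, nth [::] ps i = a :: s.
Proof.
have := all_nthP [::] ps_nonempty i (ltn_ord i); case: (nth _ _ _) => // a s _.
by exists a, s.
Qed.

Lemma piece_notin (i : 'I_q) v : v \in nth [::] ps i -> v \notin vertices v0 bs.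
Proof.
move=> vi; have : v \in flatten ps by apply/flattenP; exists (nth [::] ps i); rewrite // mem_nth.
by rewrite ps_cover.
Qed.

Lemma v0_vertices : v0 \in vertices v0 bs.
Proof. by rewrite mem_cat inE eqxx orbT. Qed.

Lemma entry_in : entry v0 bs \in vertices v0 bs.
Proof. by have [s ->] := entry_vertices v0 bs; rewrite mem_head. Qed.

Lemma option_inj (f : option 'I_q -> T) :
  f None \in vertices v0 bs -> (forall i, f (Some i) \in nth [::] ps i) -> injective f.
Proof.
move=> fN fS [i|] [j|] //= E.
- congr Some; apply: val_inj; apply: (uniq_flatten_nth ups (ltn_ord i) (ltn_ord j) (fS i)).
  by rewrite E.
- by have := piece_notin (fS i); rewrite E fN.
- by have := piece_notin (fS j); rewrite -E fN.
Qed.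

Lemma y_inj : injective y.
Proof.
apply: option_inj => [|i]; first exact: v0_vertices.
by rewrite /y; have [a [s ->]] := nth_piece i; rewrite mem_head.
Qed.

Lemma x_inj : injective x.
Proof.
apply: option_inj => [|i]; first exact: entry_in.
by rewrite /x; have [a [s ->]] := nth_piece i; rewrite /= mem_last.
Qed.

Lemma uniq_b_vertices : uniq (flatten (map (@b_vertices T) bs)).
Proof. by move: uv; rewrite cat_uniq => /and3P []. Qed.

Lemma uniq_starts : uniq (map (@b_start T) bs).
Proof.
apply: subseq_uniq uniq_b_vertices; elim: bs => //= b bs' IH.
by rewrite eqxx (subseq_trans IH) // suffix_subseq.
Qed.

Lemma uniq_exits : uniq (map (@b_exit T) bs).
Proof.
have : forall b, b \in bs -> b_exit b \in b_path b.
  move=> b; elim: bs v0 abs => //= b' bs' IH a [[[_ _ VR _ _] _ _ _] _ /IH ib].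
  by rewrite inE => /orP [/eqP ->|//]; rewrite (perm_mem VR) mem_head.
have := uniq_b_vertices; elim: bs => // b bs' IH u ib.
have {u} : uniq (b_vertices b ++ flatten (map (@b_vertices T) bs')) by [].
rewrite cat_uniq => /and3P [_ dis u]; rewrite /= IH // ?andbT; last by move=> b' b'b; apply: ib; rewrite inE b'b orbT.
apply/mapP => [[b' b'b E]].
have ex' : b_exit b' \in flatten (map (@b_vertices T) bs').
  apply/flattenP; exists (b_vertices b'); first exact: map_f.
  by rewrite /b_vertices inE mem_cat ib ?orbT // inE b'b orbT.
by have := hasPn dis _ ex'; rewrite /= -E inE mem_cat ib ?mem_head // orbT.
Qed.

Lemma rainbow_hamilton_cycle : exists s0 s,
  [/\ uniq (s0 :: s), (s0 :: s) =i T, path e s0 (rcons s s0) &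
      uniq (pairmap c s0 (rcons s s0))].
Proof.
have wI : 4 * (#|{: option 'I_q}| + 4 * M) <= w by rewrite card_option card_ord.
have [g [g_inj g_bs g_abs g_col]] := choose_blocks col_le uniq_starts uniq_exits y_inj x_inj
  w_gt0 wI (fun i => absorb_ge (y i, x i)).
have ubs : uniq bs by apply: map_uniq uniq_starts.
pose fs := [seq g (Some i) | i <- enum 'I_q].
(* Off [fs] the index equals [size ps], so the default value says that nothing is inserted. *)
pose ins b := nth [::] ps (index b fs).
have ufs : uniq fs by rewrite map_inj_uniq ?enum_uniq // => i j /g_inj [].
have insS (i : 'I_q) : ins (g (Some i)) = nth [::] ps i.
  by rewrite /ins /fs index_map ?index_enum_ord // => j k /g_inj [].
have insN b : b \notin fs -> ins b = [::].
  by rewrite -index_mem -leqNgt size_map size_enum_ord => bq; rewrite /ins nth_default.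
have fsP b : b \in fs -> exists i, b = g (Some i) by case/mapP => i _ ->; exists i.
have fs_bs : {subset fs <= bs} by move=> b /fsP [i ->].
have insF (B : eqType) (F : seq T -> seq B) : F [::] = [::] ->
    perm_eq (flatten [seq F (ins b) | b <- bs]) (flatten (map F ps)).
  move=> F0; have pbs : perm_eq bs (fs ++ [seq b <- bs | b \notin fs]).
    apply: uniq_perm => // [|b].
      rewrite cat_uniq ufs filter_uniq // andbT; apply/hasPn => b.
      by rewrite mem_filter => /andP [].
    rewrite mem_cat mem_filter; case: (boolP (b \in fs)) => //= /fs_bs ->//.
  apply: perm_trans (perm_flatten (perm_map (fun b => F (ins b)) pbs)) _.
  rewrite map_cat flatten_cat.
  have -> : flatten [seq F (ins b) | b <- [seq b <- bs | b \notin fs]] = [::].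
    elim: (bs) => //= b bs' IH; case: ifP => //= bf; by rewrite insN ?bf // F0 IH.
  rewrite cats0 /fs -map_comp; apply/seq.permP => P; congr (count P (flatten _)).
  rewrite -[in RHS](mkseq_nth [::] ps) /mkseq -val_enum_ord -!map_comp.
  by apply: eq_map => i /=; rewrite insS.
pose g0 := g None; pose s := b_start g0; pose z := b_exit g0.
have g0fs : g0 \notin fs by apply/negP => /fsP [i /g_inj].
have y_abs i : [/\ reserved e c U (y i) (b_start (g i)), reserved e c U (x i) (b_exit (g i)) &
    c (y i) (b_start (g i)) != c (x i) (b_exit (g i))] by exact/and3P/(g_abs i).
have insertableP : all (insertable e ins) bs.
  apply/allP => b _; rewrite /insertable.
  have [/fsP [i ->]|/insN -> //] := boolP (b \in fs).
  have [/andP [r1 _] /andP [r2 _] _] := y_abs (Some i).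
  have := all_nthP [::] ps_path i (ltn_ord i); rewrite insS; move: r1 r2; rewrite /y /x.
  have [a [l ->]] /= := nth_piece i => r1 r2 pl; rewrite e_sym r1 r2 andbT.
  by apply: sub_path pl => u v /andP [/andP []].
have [bs1 [bs2 bsE]] : exists bs1 bs2, bs = bs1 ++ g0 :: bs2.
  by case/path.splitPr: (g_bs None) => bs1 bs2; exists bs1, bs2.
have abs12 := abs; rewrite bsE in abs12.
have [abs1' [ok_g0 _ abs2]] := absorber_cat abs12.
have abs1 : absorber e c U s bs1 := abs1'.
have /andP [ins1 /= /andP [_ ins2]] : all (insertable e ins) bs1 && all (insertable e ins) (g0 :: bs2).
  by rewrite -all_cat -bsE.
have g0n1 : g0 \notin bs1.
  by move: ubs; rewrite bsE cat_uniq => /and3P [_ /hasPn/(_ g0 (mem_head _ _)) + _].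
have g0n2 : g0 \notin bs2 by move: ubs; rewrite bsE cat_uniq => /and3P [_ _ /andP []].
pose x2 := entry v0 bs2; pose s0 := entry v0 bs.
have s0E : s0 = entry s bs1 by rewrite /s0 bsE entry_cat.
pose t2 := b_rest g0 ++ b_link g0 ++ x2 :: route ins v0 bs2 [::].
pose r1 := route ins s bs1 [::].
have [[pV pR VR lV _] pC _ _] := ok_g0.
have r1_path : path e s0 r1 by rewrite s0E; exact: route_path abs1 ins1 _.
have r1_last : last s0 r1 = s by rewrite s0E route_last.
have t2_path : path e z t2.
  rewrite /t2 cat_path (unreserved_path pR) -lV -cat_rcons cat_path (unreserved_path pC).
  by rewrite last_rcons; exact: route_path abs2 ins2 _.
have t2_last : last z t2 = v0 by rewrite /t2 !last_cat /= route_last.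
have rev_t2 : rev (z :: t2) = v0 :: rev (belast z t2) by rewrite lastI rev_rcons t2_last.
have rev_last a : last a (rev (z :: t2)) = z by rewrite rev_cons last_rcons.
have [/andP [rs' _] /andP [rz' _] _] := y_abs None.
have rs : e s v0 by rewrite e_sym.
have rz : e z s0 by rewrite e_sym.
(* The absorbing path runs from [s0] to [v0] and its block [g0] closes it: cut it after [s],
   join [s] to [v0], traverse the rest backwards to [z], and return to [s0]. *)
exists s0, (r1 ++ rev (z :: t2)).
have vperm : perm_eq (s0 :: r1 ++ rev (z :: t2)) (vertices v0 bs ++ flatten ps).
  have /seq.permP insid : perm_eq (flatten (map ins bs)) (flatten ps).
    by have := insF _ id erefl; rewrite map_id.
  have /seq.permP p1 := route_perm ins [::] abs1.
  have /seq.permP p2 := route_perm ins [::] abs2.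
  apply/seq.permP => P; have := p1 P; have := p2 P; have := insid P; have := seq.permP VR P.
  rewrite /vertices bsE !map_cat !flatten_cat /= insN // -/x2 -/r1 -s0E.
  rewrite /t2 !count_cat /= !count_cat /= count_rev /= !count_cat /=.
  rewrite -/s -/z; move: (P s) (P z); clear; lia.
have new_uniq : uniq (vertices v0 bs ++ flatten ps).
  rewrite cat_uniq uv ups andbT; apply/hasPn => v; rewrite ps_cover //.
split.
- by move: new_uniq; rewrite -(perm_uniq vperm).
- by move=> v; have := perm_mem vperm v; rewrite mem_cat ps_cover !inE orbN.
- rewrite rcons_cat cat_path r1_path r1_last rcons_path rev_last rz andbT rev_t2 /= rs.
  by rewrite -t2_last path_rev_belast.
have t2E : pairmap c z t2 =
    pairmap c z (b_rest g0) ++ link_colours c g0 x2 ++ pairmap c x2 (route ins v0 bs2 [::]).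
  by rewrite /t2 pairmap_cat -lV -cat_rcons pairmap_cat last_rcons.
pose rot' b := (ins b != [::]) || (b == g0).
pose newc b := if b == g0 then [:: c s v0; c z s0] else new_colours c ins b.
have base_eq a l : g0 \notin l -> all_base c (fun b => ins b != [::]) a l = all_base c rot' a l.
  elim: l => //= b l IH; rewrite inE negb_or => /andP [gb /IH ->].
  by rewrite /base_colours /rot' [b == g0]eq_sym (negPf gb) orbF.
have newc_eq l : g0 \notin l -> map newc l = map (new_colours c ins) l.
  elim: l => //= b l IH; rewrite inE negb_or => /andP [gb /IH ->].
  by rewrite /newc [b == g0]eq_sym (negPf gb).
have colperm : perm_eq (pairmap c s0 (rcons (r1 ++ rev (z :: t2)) s0))
    (all_base c rot' v0 bs ++ flatten (map newc bs) ++ flatten (map (path_colours c) ps)).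
  have /seq.permP pc := insF _ (path_colours c) erefl.
  have /seq.permP p1 := route_colours ins [::] abs1.
  have /seq.permP p2 := route_colours ins [::] abs2.
  rewrite rcons_cat pairmap_cat r1_last rev_t2 rcons_cons /= pairmap_rcons.
  have -> : pairmap c v0 (rev (belast z t2)) = rev (pairmap c z t2).
    by rewrite -pairmap_rev_belast // t2_last.
  have -> : last v0 (rev (belast z t2)) = z by have := rev_last v0; rewrite rev_t2.
  have rot_g0 : rot' g0 by rewrite /rot' eqxx orbT.
  have newc_g0 : newc g0 = [:: c s v0; c z s0] by rewrite /newc eqxx.
  apply/seq.permP => P; have := p1 P; have := p2 P; have := pc P.
  rewrite (base_eq s bs1 g0n1) (base_eq v0 bs2 g0n2) bsE all_base_cat !map_cat !flatten_cat /= newc_g0 !newc_eq // insN //.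
  rewrite /base_colours rot_g0 -s0E -/r1 -/x2.
  rewrite -cats1 ?count_cat /= ?count_cat ?count_rev ?t2E /= ?count_cat /= ?count_cat /=.
  by change (entry v0 (g0 :: bs2)) with s; rewrite -/z; clear; lia.
have newP b : b \in bs -> newc b = [::] \/ exists2 i, b = g i &
    newc b = [:: c (y i) (b_start b); c (x i) (b_exit b)].
  rewrite /newc => bbs; case: eqP => [->|_].
    by right; exists None => //; rewrite c_sym [c z s0]c_sym.
  rewrite /new_colours; have [/fsP [i ->]|/insN -> //] := boolP (b \in fs); last by left.
  right; exists (Some i) => //; rewrite insS /y /x; have [a [l ->]] := nth_piece i.
  by rewrite /= [c a _]c_sym.
have newU k : k \in flatten (map newc bs) -> k \in U.
  case/flattenP => _ /mapP [b bbs ->]; case: (newP b bbs) => [-> //|[i bi ->]].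
  have [/andP [_ u1] /andP [_ u2] _] := y_abs i.
  by rewrite bi !inE => /orP [] /eqP ->.
have new_rainbow : uniq (flatten (map newc bs)).
  apply: uniq_flatten_map => // [b bbs|b b' bbs b'bs bb'].
    case: (newP b bbs) => [-> //|[i bi ->]]; have [_ _] := y_abs i.
    by rewrite /= inE bi => ->.
  case: (newP b bbs) => [->|[i bi ->]]; first by apply/hasPn.
  case: (newP b' b'bs) => [->//|[j bj ->]].
  by rewrite bi bj; apply: g_col; apply: contraNneq bb' => ij; rewrite bi bj ij.
have pathsN k : k \in flatten (map (path_colours c) ps) ->
    (k \notin U) && (k \notin all_colours c v0 bs).
  case/flattenP => _ /mapP [p pps ->]; move/allP: ps_path => /(_ p pps).
  case: p {pps} => //= a l; elim: l a => //= a' l IH a /andP [/andP [/andP [_ aU] aS] /IH {}IH].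
  by rewrite inE => /orP [/eqP ->|/IH //]; rewrite aU aS.
have baseN k : k \in all_base c rot' v0 bs -> (k \notin U) && (k \in all_colours c v0 bs).
  by move/(all_base_sub (c := c)) => kS; rewrite kS (all_colours_unreserved abs).
(* The three groups of colours are disjoint: joining edges have colours in [U] and the others do
   not, while the covering paths avoid [all_colours], which contains the colours of the absorbing
   path. *)
rewrite (perm_uniq colperm) cat_uniq (uniq_all_base _ abs) cat_uniq new_rainbow ps_rainbow.
rewrite andbT /=; apply/andP; split; apply/hasPn => k.
  rewrite mem_cat => /orP [/newU kU|/pathsN /andP [_ kS]]; apply/negP => /baseN /andP [].
    by rewrite kU.
  by rewrite (negPf kS).
by move/pathsN/andP => [kU _]; apply: contra kU => /newU.
Qed.

End Assembly.

(** * Choice of constants *)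

(** Ensures that the initial potential [#|T| * #|T|] is at most [2 ^ u] for a unit [u] linear in
    [#|T|]. *)
Lemma square_le_exp2 (C : nat) : exists u0, forall u, u0 <= u -> (C * u) * (C * u) <= 2 ^ u.
Proof.
exists (4 * (64 * (C * C) + 1)) => u hu.
pose k := u %/ 4; have uk : u < 4 * k + 4 by rewrite /k; lia.
have ku : 4 * k <= u by rewrite /k; lia.
have k0 : 64 * (C * C) + 1 <= k by rewrite /k; lia.
have k2 : k <= 2 ^ k by apply: ltnW; exact: ltn_expl.
apply: leq_trans (_ : 2 ^ (3 * k) <= _); last by rewrite leq_exp2l //; lia.
have -> : 3 * k = k + k + k by lia.
rewrite !expnD; apply: leq_trans (leq_mul (leq_mul k2 k2) k2).
have u8 : u <= 8 * k by lia.
apply: leq_trans (leq_mul (leq_mul (leqnn C) u8) (leq_mul (leqnn C) u8)) _.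
apply: leq_trans (_ : 64 * (C * C) * (k * k) <= _); first by clear; nia.
by rewrite mulnC leq_mul2l; apply/orP; right; lia.
Qed.

Section ColourSplit.
Variables (T K : finType) (e : rel T) (c : T -> T -> K) (M q : nat).
Hypothesis col_le : forall k, #|[set p : T * T | e p.1 p.2 && (c p.1 p.2 == k)]| <= M.

Lemma colour_split : 0 < q -> exists U : {set K}, forall v,
  #|neighbours e v| <= q * (#|[set u | reserved e c U v u]| + M) /\
  q * #|[set u | reserved e c U v u]| <= #|neighbours e v| + q * M.
Proof.
move=> q0; pose A v k := #|[set u | e v u && (c v u == k)]|.
have sumA k : \sum_v A v k <= M.
  by apply: leq_trans (col_le k); rewrite (card_pairs (fun x y => e x y && (c x y == k))).
have [U HU] := proportional_columns q0 sumA.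
have part v (S : {set K}) : \sum_(k in S) A v k = #|[set u | e v u && (c v u \in S)]|.
  rewrite -sum1dep_card (partition_big (c v) (mem S)) => [|u /andP [] //].
  apply: eq_bigr => k kS; rewrite /A -sum1dep_card; apply: eq_bigl => u.
  by case: eqP => [->|_]; rewrite ?kS ?andbT ?andbF.
exists U => v; have := HU v; rewrite part.
have <- : \sum_k A v k = #|neighbours e v|; last by [].
have := part v setT; under eq_bigl do rewrite in_setT.
by move=> ->; apply: eq_card => u; rewrite !inE andbT.
Qed.
End ColourSplit.

Section Main.
Variable D : nat.
Hypothesis D_gt0 : 0 < D.
Let kb := block_size D.
(** All sizes are measured in the unit [u = h %/ W]. The [4 * (q * q) * u] blocks and the
    lower-order terms fit into [X * u] vertices, and [W] makes [X * u] small against both [h] and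
    the reserved degrees. As [2 * D * W = q * X], one gets [#|T| <= q * (X * u)] with [q] depending
    on [D] alone, so the choice is not circular. [L] is [16 * (2 * D * W)], for at most [u / 16]
    cycles, and [Y] makes [M] at most [u / Y]. *)
Let q := 16 * (D * D).
Let X := 4 * (q * q) * kb + 100 * kb.
Let W := 8 * D * X.
Let L := 32 * D * W.
Let Y := 1000 * D * kb.

Lemma kb_ge : 2 + D.+1.*2 <= kb.
Proof. by rewrite /kb /block_size; clear; nia. Qed.

Theorem robust_rainbow_hamilton : exists Bg n0 : nat,
  forall (T K : finType) (e : rel T) (c : T -> T -> K) (h t d M : nat),
  n0 <= #|T| -> symmetric e -> (forall x y, c x y = c y x) ->
  #|T| <= D * h -> h <= t -> 4 * t <= d -> (forall v, d <= #|neighbours e v|) ->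
  robustly_expanding e h t ->
  (forall k, #|[set p : T * T | e p.1 p.2 && (c p.1 p.2 == k)]| <= M) ->
  Bg * M <= #|T| ->
  exists s0 s, [/\ uniq (s0 :: s), (s0 :: s) =i T, path e s0 (rcons s s0) &
      uniq (pairmap c s0 (rcons s s0))].
Proof.
have [u1 hu1] := square_le_exp2 (2 * D * W).
pose u0 := u1 + 32 * (L.+1 * D.+1.*2) + 8.
exists (2 * D * W * Y), (D * W * u0) => T K e c h t d M n0T e_sym c_sym n_le h_le_t t_le_d deg robust col_le MT.
have kb2 := kb_ge.
have X0 : 0 < X by move: kb2; rewrite /X; clear; nia.
have W0 : 0 < W by rewrite /W muln_gt0 X0 muln_gt0 D_gt0.
have hW : W * u0 <= h.
  by rewrite -(leq_pmul2l D_gt0) mulnA; apply: leq_trans n0T n_le.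
pose u := h %/ W.
have u0u : u0 <= u by rewrite /u leq_divRL // mulnC.
have Wu : W * u <= h by rewrite mulnC leq_trunc_div.
have hWu : h < W * u.+1 by rewrite mulnC -ltn_divLR.
have u_ge : [/\ u1 <= u, 8 <= u & 32 * (L.+1 * D.+1.*2) <= u].
  by move: u0u; rewrite /u0; clear; move: (32 * _) => a; split; lia.
have [u1u u8 uL] := u_ge.
have nu : #|T| <= 2 * D * W * u.
  by move: n_le hWu u8; clear; move: #|T| => n; nia.
have MY : Y * M <= u.
  have DW0 : 0 < 2 * D * W by rewrite muln_gt0 W0 muln_gt0 D_gt0.
  by rewrite -(leq_pmul2l DW0) mulnA; apply: leq_trans nu.
have h_gt0 : 0 < h by apply: leq_trans Wu; rewrite muln_gt0 W0; lia.
(* Below, [X * u] dominates every lower-order quantity. *)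
have Xu : 8 * (X * u) <= h by apply: leq_trans Wu; rewrite /W; move: D_gt0; clear; nia.
have M1 : 1000 * (D * kb * M) <= u by apply: leq_trans MY; rewrite /Y; clear; nia.
have DM : D * M <= D * kb * M by rewrite leq_mul2r leq_pmulr ?orbT //; lia.
have M_DM : M <= D * M by rewrite leq_pmull.
have kbM : kb * M <= D * kb * M by rewrite -mulnA leq_pmull.
have uX : 100 * kb * u + 4 * (q * q) * kb * u = X * u by rewrite /X; clear; nia.
have kbu : kb * 8 <= kb * u by rewrite leq_mul2l u8 orbT.
have ukbu : u * 8 <= kb * u * 4 by move: kb2; clear; nia.
(* At density [1 / (8D)] a vertex has at most [h / 8 + M <= h / 4] reserved neighbours, but, as
   [d >= 4 * h], at least [h / (2D) - M] of them. *)
have [|U HU] := @colour_split T K e c M (8 * D) col_le _; first by rewrite muln_gt0.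
have M_h : 16 * M <= h by move: Xu uX kbu M1 DM M_DM ukbu; clear; nia.
have U_small v : 4 * #|[set u | e v u && (c v u \in U)]| <= h.
  have [_] := HU v; have : #|neighbours e v| <= #|T| by exact: max_card.
  rewrite -/(reserved e c U v); move: n_le M_h; rewrite /reserved.
  by move: D_gt0; card_nia.
pose N := 4 * (q * q) * u.
have Nkb : N * kb + 100 * kb * u = X * u by rewrite /N /X; clear; nia.
have T_gt0 : 0 < #|T|.
  apply: leq_trans n0T; rewrite muln_gt0 muln_gt0 D_gt0 W0 /u0; clear; lia.
have /card_gt0P [v0 _] := T_gt0.
have h_n : 4 * h <= #|T|.
  have := max_card (neighbours e v0); have := deg v0; move: h_le_t t_le_d; card_lia.
have res_ge v : X * u + (1 + N * kb + 16 * D * M) + 1 + M <= #|[set w | reserved e c U v w]|.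
  have [+ _] := HU v; have := deg v; set r := #|[set _ | _]|; move=> dv hr.
  have : 4 * (X * u) <= r + M.
    have D2 : 0 < 2 * D by rewrite muln_gt0.
    rewrite -(leq_pmul2l D2); move: dv hr h_le_t t_le_d Wu; rewrite /W; clear.
    by move: #|_| => n; nia.
  by move: Nkb M1 DM M_DM ukbu kbu kb2; clear; lia.
have cond4 : 2 * (1 + N * kb + (2 * kb + 5) + 24 * D * M) <= h.
  by move: Nkb M1 DM Xu ukbu kbu kb2; clear; lia.
have hnum1 : 8 * (D.+1.*2 + 2 * (2 * kb + 5 + D.+1.*2) * M) < 3 * h.
  have : D.+1.*2 * M <= kb * M by rewrite leq_mul2r; apply/orP; right; lia.
  by move: Nkb M1 DM M_DM kbM Xu ukbu kbu kb2; clear; lia.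
have hM : 16 * kb * M <= h by move: Nkb M1 kbM Xu ukbu; clear; lia.
have n_qa : #|T| <= q * (X * u).
  by apply: leq_trans nu _; rewrite /W /q; clear; nia.
have n2 : #|T| * #|T| <= 2 ^ u by apply: leq_trans (hu1 u u1u); exact: leq_mul.
have u_gt0 : 0 < u by apply: leq_trans u8.
have Xu0 : 0 < X * u by rewrite muln_gt0 X0.
have [bs [[sbs abs uv sv sS] cnt]] := @absorbing_path_exists T K e c U D h t d M e_sym c_sym h_gt0
  n_le h_le_t t_le_d deg robust col_le U_small N u q (X * u) v0 D_gt0 Xu0 erefl n2 n_qa res_ge
  cond4 hnum1 hM.
pose A := [set v in vertices v0 bs].
have cA : #|A| = 1 + N * kb by rewrite cardsE (card_uniqP uv).
have A_le : 2 * (#|A| + 24 * D * M) <= h by rewrite cA; move: cond4; clear; lia.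
have SA_le : size (all_colours c v0 bs) <= #|T| by apply: leq_trans sS _; move: h_n; card_lia.
have LA : L < #|~: A|.
  have := cardsC A; rewrite cA.
  have : L <= u by move: uL; clear; nia.
  by move: cond4 h_n Xu ukbu kbu kb2 uX h_gt0; card_lia.
have hnum2 : 8 * (2 * L.+1 * D.+1.*2 + 2 * D.+1.*2 * M) < 3 * h.
  have : D.+1.*2 * M <= kb * M by rewrite leq_mul2r; apply/orP; right; lia.
  by move: uL M1 kbM Xu uX ukbu kbu kb2; clear; lia.
have [ps [ups eps nps sps [pps rps]]] := @rainbow_path_cover T K e c U D h t d M e_sym c_sym h_gt0
  n_le h_le_t t_le_d deg robust col_le U_small A (all_colours c v0 bs) L D_gt0 SA_le A_le hnum2 LA.
have w_ge : 4 * ((size ps).+1 + 4 * M) <= u.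
  have L0 : 0 < L by rewrite /L muln_gt0 W0 muln_gt0 D_gt0.
  have : 16 * size ps <= 16 * (32 * D * M) + u.
    have Lu : L * u = 16 * (2 * D * W * u) by rewrite /L; clear; lia.
    rewrite -(leq_pmul2l L0); move: sps nu Lu; move: #|T| (size ps) (2 * D * W * u) => n a b.
    by clear; nia.
  by move: M1 DM M_DM u8; clear; lia.
apply: (@rainbow_hamilton_cycle T K e c U M u e_sym c_sym col_le v0 bs ps abs uv ups _ nps pps rps
  u_gt0 w_ge cnt).
by move=> v; rewrite eps !inE.
Qed.
End Main.

(** * From real to natural parameters *)

Lemma map_zip_pairmap (A B : Type) (f : A -> A -> B) x s y :
  [seq f p.1 p.2 | p <- zip (x :: s) (rcons s y)] = pairmap f x (rcons s y).
Proof. by elim: s x => //= a s IHs x; rewrite -IHs. Qed.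

Lemma all_zip_path (A : Type) (r : rel A) x s y :
  all (fun p => r p.1 p.2) (zip (x :: s) (rcons s y)) = path r x (rcons s y).
Proof. by elim: s x => //= a s IHs x; rewrite -IHs. Qed.

Section Recolour.
Variables (n : nat) (e : rel 'I_n) (C : eqType) (c : 'I_n -> 'I_n -> C).
Hypotheses (e_irr : forall x, ~~ e x x) (e_sym : symmetric e).
Hypothesis c_sym : edge_colouring e c.

(** [edge_colouring] gives symmetry on edges only; the combinatorial part assumes it for all
    pairs. *)
Definition sym_colour (x y : 'I_n) : C := if x < y then c x y else c y x.

(* A pair of vertices represents the colour it carries, so that colours form a finite type. *)
Definition recolour (x y : 'I_n) : 'I_n * 'I_n :=
  nth (x, y) (enum {: 'I_n * 'I_n})
    (index (sym_colour x y) [seq sym_colour p.1 p.2 | p <- enum {: 'I_n * 'I_n}]).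

Lemma sym_colourC x y : sym_colour x y = sym_colour y x.
Proof. by rewrite /sym_colour; case: ltngtP => // /val_inj ->. Qed.

Lemma sym_colourE x y : e x y -> sym_colour x y = c x y.
Proof. by move=> exy; rewrite /sym_colour; case: ifP => // _; rewrite c_sym // e_sym. Qed.

Lemma sym_colour_index x y :
  index (sym_colour x y) [seq sym_colour p.1 p.2 | p <- enum {: 'I_n * 'I_n}] <
  size (enum {: 'I_n * 'I_n}).
Proof.
rewrite -(size_map (fun p => sym_colour p.1 p.2)) index_mem.
by apply/mapP; exists (x, y); rewrite ?mem_enum.
Qed.

Lemma recolour_eq x y u v :
  (recolour x y == recolour u v) = (sym_colour x y == sym_colour u v).
Proof.
have key a b : sym_colour (recolour a b).1 (recolour a b).2 = sym_colour a b.
  rewrite /recolour; have := sym_colour_index a b => h.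
  rewrite -(nth_map _ (sym_colour a b) (fun p => sym_colour p.1 p.2)) //.
  by rewrite nth_index // -index_mem size_map.
apply/eqP/eqP => [E|E]; first by rewrite -key E key.
rewrite /recolour -E; apply: set_nth_default; exact: sym_colour_index.
Qed.

Lemma recolourC x y : recolour x y = recolour y x.
Proof. by apply/eqP; rewrite recolour_eq sym_colourC. Qed.

(** The factor 2 converts edges, counted once in [colour_class], into ordered pairs. *)
Lemma card_recolour (m : nat) k :
  (forall col, 2 * #|colour_class e c col| <= m) ->
  #|[set p : 'I_n * 'I_n | e p.1 p.2 && (recolour p.1 p.2 == k)]| <= m.
Proof.
move=> cm; set S := [set p | _].
have [->|/set0Pn [p0]] := eqVneq S set0; first by rewrite cards0.
rewrite inE => /andP [_ /eqP kE]; pose col := sym_colour p0.1 p0.2.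
pose swap (p : 'I_n * 'I_n) := (p.2, p.1).
have sub : S \subset colour_class e c col :|: swap @: colour_class e c col.
  apply/subsetP => [[x y]]; rewrite inE -kE recolour_eq /= => /andP [exy /eqP cE].
  have eyx : e y x by rewrite e_sym.
  case: (ltngtP x y) => [xy|yx|/val_inj xy].
  - by rewrite !inE /= xy exy -(sym_colourE exy) /col cE eqxx.
  - apply/setUP; right; apply/imsetP; exists (y, x) => //.
    by rewrite inE /= yx eyx -(sym_colourE eyx) /col -cE sym_colourC eqxx.
  - by move: exy; rewrite xy (negPf (e_irr y)).
apply: leq_trans (cm col); apply: leq_trans (subset_leq_card sub) _.
by apply: leq_trans (card_setU_le _ _) _; rewrite mul2n -addnn leq_add2l leq_imset_card.
Qed.

Lemma hamilton_of_recolour x s : (3 <= n)%N ->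
  uniq (x :: s) -> (x :: s) =i 'I_n -> path e x (rcons s x) ->
  uniq (pairmap recolour x (rcons s x)) ->
  hamilton_cycle e (x :: s) /\ rainbow_cycle c (x :: s).
Proof.
move=> n3 us sT ps ucs.
have sz : size (x :: s) = n by rewrite -(card_uniqP us) (eq_card sT) card_ord.
split; first by split=> //; rewrite sz.
rewrite /rainbow_cycle rot1_cons; move: ucs; rewrite -map_zip_pairmap => ucs.
have : all (fun p => e p.1 p.2) (zip (x :: s) (rcons s x)) by rewrite all_zip_path.
move/allP => edges; rewrite map_inj_in_uniq; first exact: map_uniq ucs.
move=> p q pz qz; rewrite -!sym_colourE ?edges // => E.
by apply: (uniq_map_inj ucs pz qz); apply/eqP; rewrite recolour_eq E.
Qed.
End Recolour.

Local Open Scope ring_scope.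

Lemma nat_ceil (R : archiRealFieldType) (a : R) : 0 <= a ->
  exists h : nat, (forall k : nat, (h <= k)%N = (a <= k%:R)) /\ h%:R < a + 1.
Proof.
move=> a0; have ex : exists k : nat, a <= k%:R.
  by exists (Num.truncn a).+1; rewrite ltW // truncnS_gt.
case: (ex_minnP ex) => h ah hmin; exists h; split.
  move=> k; apply/idP/idP => [hk|/hmin //]; apply: le_trans ah _; by rewrite ler_nat.
case: h ah hmin => [|h] ah hmin; first by rewrite ltr_wpDl.
rewrite -natr1 ltrD2r ltNge; apply/negP => /hmin; by rewrite ltnn.
Qed.

Theorem mainTheorem15 (R : archiRealFieldType) :
  forall gamma : R, 0 < gamma < 1 ->
  exists2 tau0 : R, 0 < tau0 &
  forall tau : R, 0 < tau <= tau0 ->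
  exists2 nu0 : R, 0 < nu0 &
  forall nu : R, 0 < nu <= nu0 ->
  exists2 mu0 : R, 0 < mu0 &
  forall mu : R, 0 < mu <= mu0 ->
  exists n0 : nat, forall n : nat, (n0 <= n)%N ->
  forall e : rel 'I_n,
    simple_graph e ->
    min_degree_ge e (gamma * n%:R) ->
    robust_expander e nu tau ->
  forall (C : eqType) (c : 'I_n -> 'I_n -> C),
    edge_colouring e c ->
    bounded_colouring e c (mu * n%:R) ->
  exists s : seq 'I_n, hamilton_cycle e s /\ rainbow_cycle c s.
Proof.
(* Rounding up gives [4 * t < 4 * tau * n + 4 <= gamma * n / 2 + 4], which is below [gamma * n] once
   [gamma * n > 8]; [n2] guarantees the latter. The comparison of [nu] with [tau] comes from
   [robust_expander]. *)
move=> gamma /andP [g0 g1]; exists (gamma / 8%:R); first by rewrite divr_gt0 ?ltr0n.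
move=> tau /andP [tau0 tau_g]; exists 1; first exact: ltr01.
move=> nu /andP [nu_gt0 _].
pose D := (Num.truncn nu^-1).+1.
have D_nu : 1 < D%:R * nu.
  by rewrite -ltr_pdivrMr // mul1r truncnS_gt.
have [Bg [n1 main]] := @robust_rainbow_hamilton D isT.
(* The 2 accounts for ordered pairs; the successor keeps the denominator positive even if [Bg] is
   0. *)
exists (2%:R * Bg.+1%:R)^-1; first by rewrite invr_gt0 mulr_gt0 ?ltr0n.
move=> mu /andP [mu0 mu_le].
pose n2 := (Num.truncn (8%:R / gamma)).+1.
exists (n1 + n2 + 3)%N => n n_ge e [e_irr e_sym] degR [_ nu_tau _ robR] C c c_sym bounded.
have nR0 : 0 <= n%:R :> R by rewrite ler0n.
have [h [hP h_lt]] := nat_ceil (mulr_ge0 (ltW nu_gt0) nR0).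
have [t [tP t_lt]] := nat_ceil (mulr_ge0 (ltW tau0) nR0).
have [d [dP _]] := nat_ceil (mulr_ge0 (ltW g0) nR0).
pose M := Num.truncn (2%:R * (mu * n%:R)).
have m0 : 0 <= 2%:R * (mu * n%:R) by rewrite !mulr_ge0 // ltW.
have n_le : (n <= D * h)%N.
  have : nu * n%:R <= h%:R by rewrite -hP.
  rewrite -(ler_nat R) natrM => hn.
  have : D%:R * (nu * n%:R) <= D%:R * h%:R by rewrite ler_wpM2l // ler0n.
  apply: le_trans; rewrite mulrA ler_peMl //; exact: ltW.
have h_le_t : (h <= t)%N.
  by rewrite hP; apply: le_trans (_ : tau * n%:R <= _); rewrite ?ler_wpM2r // -tP.
have t_le_d : (4 * t <= d)%N.
  have gn : 8%:R < gamma * n%:R.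
    have : 8%:R / gamma < n2%:R by exact: truncnS_gt.
    rewrite ltr_pdivrMr // mulrC => /lt_le_trans; apply; rewrite ler_wpM2l ?(ltW g0) //.
    by rewrite ler_nat; move: n_ge; clear; lia.
  have : gamma * n%:R <= d%:R by rewrite -dP.
  have : tau * n%:R <= gamma / 8%:R * n%:R by rewrite ler_wpM2r.
  rewrite -(ler_nat R) natrM mulrAC; move: t_lt gn; set x := gamma * n%:R.
  by move: (t%:R) (d%:R) (tau * n%:R) x => t' d' y x; clear; lra.
have deg v : (d <= #|neighbours e v|)%N by rewrite dP; exact: degR.
have rob : robustly_expanding e h t.
  move=> X tX Xt; rewrite card_ord in Xt.
  have := robR X; rewrite -tP => /(_ tX).
  have -> : #|X|%:R <= (1 - tau) * n%:R :> R.
    have : tau * n%:R <= t%:R by rewrite -tP.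
    by move: Xt; rewrite -(ler_nat R) natrD mulrBl mul1r; lra.
  move=> /(_ isT); have -> : robust_nbhd e nu X = [set v | (h <= #|neighbours e v :&: X|)%N].
    by apply/setP => v; rewrite !inE hP.
  set N := [set v | _] => XN.
  (* The gain [#|N| - #|X|] is an integer, hence at least the ceiling [h] of [nu * n]; this
     inequality makes the subtraction on naturals faithful. *)
  have XN' : (#|X| <= #|N|)%N.
    rewrite -(ler_nat R); apply: le_trans XN; rewrite lerDl mulr_ge0 // ltW //.
  by rewrite -leq_subRL // hP natrB // lerBrDl.
have col_le k : (#|[set p : 'I_n * 'I_n | e p.1 p.2 && (recolour c p.1 p.2 == k)]| <= M)%N.
  apply: card_recolour => // col; rewrite truncn_ge_nat // natrM ler_wpM2l // ler0n.
have BM : (Bg * M <= n)%N.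
  have M_le : M%:R <= 2%:R * (mu * n%:R) by rewrite truncn_le.
  rewrite -(ler_nat R) natrM; have B_mu : mu * (2%:R * Bg.+1%:R) <= 1.
    by move: mu_le; rewrite -[X in _ <= X]mul1r ler_pdivlMr // mulr_gt0 ?ltr0n.
  apply: le_trans (_ : Bg.+1%:R * (2%:R * (mu * n%:R)) <= _).
    by apply: ler_pM => //; rewrite ?ler0n // ler_nat.
  have -> : Bg.+1%:R * (2%:R * (mu * n%:R)) = mu * (2%:R * Bg.+1%:R) * n%:R by ring.
  by rewrite ler_piMl.
have [|||s0 [s [us sT ps ucs]]] := main _ _ e (recolour c) h t d M _ e_sym (recolourC c) _
  h_le_t t_le_d deg rob col_le _.
- by rewrite card_ord; move: n_ge; clear; lia.
- by rewrite card_ord.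
- by rewrite card_ord.
exists (s0 :: s); apply: hamilton_of_recolour => //.
by move: n_ge; clear; lia.
Qed.
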